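(* (Composite case.) Let $1\le q\le p$ and suppose that AS.1–AS.4 (see context) hold. Suppose that the AR$qp$C algorithm (see context) is applied with accuracy $\epsilon=(\epsilon_1,\dots,\epsilon_q)$, and that its optimality radii obey the radius rule (see context): for each $k$, either $\delta_{k+1,j}=1$ for all $j\in\{1,\dots,q\}$ if the good-case condition (GC) holds, or the lower bound (RD) holds otherwise. 1. Suppose that $\mathcal F$ is convex, $q=1$ and $h$ is convex. Then there exist positive constants $\kappa^{s,1}$, $\kappa^{a,1}$, $\kappa^{c}$ (independent of $\epsilon$) such that, for any $\epsilon_1\in(0,1]$, the algorithm requires at most $$\kappa^{a,1}\,\frac{w(x_0)-w_{\rm low}}{\epsilon_1^{\frac{p+1}{p}}}+\kappa^{c}=\mathcal O\Big(\epsilon_1^{-\frac{p+1}{p}}\Big)$$ evaluations of $f$ and $c$, and at most $$\kappa^{s,1}\,\frac{w(x_0)-w_{\rm low}}{\epsilon_1^{\frac{p+1}{p}}}+1=\mathcal O\Big(\epsilon_1^{-\frac{p+1}{p}}\Big)$$ evaluations of the derivatives of $f$ and $c$ of orders one to $p$, to produce an iterate $x_\epsilon$ such that $\phi_{w,1}^{1}(x_\epsilon)\le\epsilon_1$. 2. Suppose that $\mathcal F$ is nonconvex or that $h$ is nonconvex or that $q>1$. Then there exist positive constants $\kappa^{s,2}$, $\kappa^{a,2}$, $\kappa^{c}$ (independent of $\epsilon$) such that, for any $\epsilon\in(0,1]^q$, the algorithm requires at most $$\kappa^{a,2}\,\frac{w(x_0)-w_{\rm low}}{\min_{j\in\{1,\dots,q\}}\epsilon_j^{j+1}}+\kappa^{c}=\mathcal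 O\Big(\max_{j\in\{1,\dots,q\}}\epsilon_j^{-(j+1)}\Big)$$ evaluations of $f$ and $c$, and at most $$\kappa^{s,2}\,\frac{w(x_0)-w_{\rm low}}{\min_{j\in\{1,\dots,q\}}\epsilon_j^{j+1}}+1=\mathcal O\Big(\max_{j\in\{1,\dots,q\}}\epsilon_j^{-(j+1)}\Big)$$ evaluations of the derivatives of $f$ and $c$ of orders one to $p$, to produce an iterate $x_\epsilon$ such that $\phi_{w,j}^{\delta_{\epsilon,j}}(x_\epsilon)\le\epsilon_j\,\delta_{\epsilon,j}^j/j!$ for some $\delta_\epsilon\in(0,1]^q$ and all $j\in\{1,\dots,q\}$.
   Context: Problem. $n,m,p,q\ge1$ are integers with $q\le p$; $\mathcal F\subseteq\mathbb R^n$ is a nonempty feasible set; $f:\mathbb R^n\to\mathbb R$, $c:\mathbb R^n\to\mathbb R^m$, $h:\mathbb R^m\to\mathbb R$; one minimizes $w(x)=f(x)+h(c(x))$ over $x\in\mathcal F$. $\|\cdot\|$ is the Euclidean norm, or the induced operator norm for tensors. All minima written below (including the global minimum of the model $m_k$ over feasible steps) are implicitly assumed to be attained. Assumptions. - AS.1: $f$ is $p$ times continuously differentiable and, for every $j\in\{1,\dots,p\}$, there is $L_{f,j}\ge1$ with $\|\nabla_x^jf(x)-\nabla_x^jf(y)\|\le L_{f,j}\|x-y\|$ for all $x,y$ in a convex open neighbourhood of $\mathcal F$. - AS.2: $c$ is $p$ times continuously differentiable and, for every $j\in\{1,\dots,p\}$, there is $L_{c,j}\ge1$ with $\|\nabla_x^jc(x)-\nabla_x^jc(y)\|\le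 L_{c,j}\|x-y\|$ for all $x,y$ in a convex open neighbourhood of $\mathcal F$. - AS.3: there is $L_{h,0}\ge0$ with $|h(x)-h(y)|\le L_{h,0}\|x-y\|$ for all $x,y\in\mathbb R^m$; moreover $h(x+y)\le h(x)+h(y)$ for all $x,y$, and $h(0)=0$. - AS.4: there is $w_{\rm low}$ with $w(x)\ge w_{\rm low}$ for all $x\in\mathcal F$. Taylor models and optimality measure. $T_{r,j}(x,s)=\sum_{\ell=0}^j\frac1{\ell!}\nabla_x^\ell r(x)[s]^\ell$ for $r=f$ or $r=c$; $T_{w,j}(x,s)=T_{f,j}(x,s)+h(T_{c,j}(x,s))$ (not a Taylor expansion); for $\delta>0$, $$\phi_{w,j}^{\delta}(x)=w(x)-\min_{x+d\in\mathcal F,\ \|d\|\le\delta}T_{w,j}(x,d).$$ Regularized model at iteration $k$: $m_k(s)=T_{w,p}(x_k,s)+\frac{\sigma_k}{(p+1)!}\|s\|^{p+1}$. Its optimality measure, for $j\le q$, is $$\phi_{m_k,j}^{\delta}(s)=m_k(s)-\min_{x_k+s+d\in\mathcal F,\ \|d\|\le\delta}\Big[\sum_{\ell=0}^j\tfrac1{\ell!}\nabla_s^\ell T_{f,p}(x_k,s)[d]^\ell+h\Big(\sum_{\ell=0}^j\tfrac1{\ell!}\nabla_s^\ell T_{c,p}(x_k,s)[d]^\ell\Big)+\tfrac{\sigma_k}{(p+1)!}\sum_{\ell=0}^j\tfrac1{\ell!}\nabla_s^\ell(\|s\|^{p+1})[d]^\ell\Big].$$ Algorithm AR$qp$C. -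 Step 0 (initialization): given are $x_0\in\mathcal F$, $\sigma_0>0$, accuracies $\epsilon\in(0,1]^q$, $\delta_0\in(0,1]^q$, $\theta\in(0,1)$, $\sigma_{\min}\in(0,\sigma_0]$, $0<\eta_1\le\eta_2<1$, $0<\gamma_1<1<\gamma_2<\gamma_3$. Compute $w(x_0)$; set $k=0$. - Step 1 (termination test): evaluate derivatives of $f,c$ at $x_k$ of orders $1,\dots,q$. If $\phi_{w,j}^{\delta_{k,j}}(x_k)\le\epsilon_j\delta_{k,j}^j/j!$ for all $j\in\{1,\dots,q\}$, terminate with $x_\epsilon=x_k$. Otherwise evaluate the derivatives of orders $q+1,\dots,p$. - Step 2 (step): compute a nonzero step $s_k$ with $x_k+s_k\in\mathcal F$ and radii $\delta_s\in(0,1]^q$ such that $m_k(s_k)\le m_k(0)$ and $\phi_{m_k,j}^{\delta_{s,j}}(s_k)\le\theta\epsilon_j\delta_{s,j}^j/j!$ for all $j\in\{1,\dots,q\}$. If no such pair exists, terminate with $x_\epsilon=x_k$. - Step 3 (acceptance): compute $w(x_k+s_k)$ and $\rho_k=\dfrac{w(x_k)-w(x_k+s_k)}{w(x_k)-T_{w,p}(x_k,s_k)}$. If $\rho_k\ge\eta_1$ set $x_{k+1}=x_k+s_k$, $\delta_{k+1}=\delta_s$ (successful iteration); otherwise $x_{k+1}=x_k$, $\delta_{k+1}=\delta_k$. - Step 4 (regularization update): choose $\sigma_{k+1}\in[\max(\sigma_{\min},\gamma_1\sigma_k),\sigma_k]$ if $\rho_k\ge\eta_2$; $\sigma_{k+1}\in[\sigma_k,\gamma_2\sigma_k]$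 if $\rho_k\in[\eta_1,\eta_2)$; $\sigma_{k+1}\in[\gamma_2\sigma_k,\gamma_3\sigma_k]$ if $\rho_k<\eta_1$. Increment $k$; go to Step 1 if the iteration just completed was successful, to Step 2 otherwise. Radius rule. Good-case condition (GC): $\mathcal F$ is convex and either ($h=0$ and $q\in\{1,2\}$) or ($h$ is convex and $q=1$). If (GC) holds, the rule means that all radii used are equal to one: $\delta_{0}=(1,\dots,1)$ and every execution of Step 2 returns a pair with $\delta_s=(1,\dots,1)$. If (GC) fails, the rule is (RD): whenever Step 2 returns a pair with $\|s_k\|\le\xi$, then for all $j\in\{1,\dots,q\}$ $$\delta_{s,j}\ge\kappa_{\delta,\min}\,\epsilon_j,\qquad \kappa_{\delta,\min}=\frac{\theta}{2\,q!\,(6L_w+3\sigma_{\max})},$$ where $L_w=\max_{j\in\{1,\dots,p\}}(L_{f,j-1}+L_{h,0}L_{c,j-1})$ (with $L_{f,0},L_{c,0}\ge1$ fixed constants), $L_{w,p}=L_{f,p}+L_{h,0}L_{c,p}$, $\sigma_{\max}=\max\big[\sigma_0,\frac{\gamma_3L_{w,p}}{1-\eta_2}\big]$ and $\xi=\Big(\frac{1-\theta}{3\,q!\,(L_{w,p}+\sigma_{\max})}\Big)^{1/(p-q+1)}\in(0,1)$. *)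

(* Defs.v *)
From HB Require Import structures.
From mathcomp Require Import all_boot all_order all_algebra.
From mathcomp Require Import all_classical all_reals all_analysis.

Set Implicit Arguments.
Unset Strict Implicit.
Unset Printing Implicit Defensive.
Import Order.TTheory GRing.Theory Num.Theory.
Import numFieldNormedType.Exports.

Local Open Scope classical_set_scope.
Local Open Scope ring_scope.

(* The norm that the library puts on 'rV[R]_n is the sup norm; it is used below
   only through the topology that it induces. *)
Definition norm2 {R : realType} {n : nat} (x : 'rV[R]_n) : R :=
  Num.sqrt (\sum_(i < n) x 0 i ^+ 2).

Section Tensors.
Context {R : realType} {n : nat} {W : normedModType R}.
Implicit Types (r : 'rV[R]_n -> W) (x s : 'rV[R]_n) (vs : seq 'rV[R]_n).

(* [nabla r [:: v1; ...; vl] x] is the l-th derivative tensor of r at x applied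
   to v1, ..., vl. *)
Definition nabla r vs : 'rV[R]_n -> W :=
  foldr (fun v g => 'D_v g) r vs.

(* p times continuously (Frechet) differentiable on the whole space. *)
Definition Cp (p : nat) r : Prop :=
  (forall vs, (size vs < p)%N -> forall x, differentiable (nabla r vs) x) /\
  (forall vs, (size vs <= p)%N -> continuous (nabla r vs)).

(* Induced operator norm of a j-tensor A with values in W, where [nW] is the
   norm used on W. *)
Definition tensor_norm (nW : W -> R) (j : nat) (A : seq 'rV[R]_n -> W) : \bar R :=
  ereal_sup [set (nW (A vs))%:E |
    vs in [set vs : j.-tuple 'rV[R]_n | forall v, v \in vs -> norm2 v = 1]].

Definition derivative_lipschitz (nW : W -> R) (F : set 'rV[R]_n) r (j : nat)
    (L : R) : Prop :=
  exists U : set 'rV[R]_n, [/\ open U, convex_set U, F `<=` U &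
    forall x y, U x -> U y ->
      (tensor_norm nW j (fun vs => nabla r vs x - nabla r vs y)%R
        <= (L * norm2 (x - y)%R)%:E)%E].

(* T_{r,j}(x,s) *)
Definition taylor r (j : nat) x s : W :=
  \sum_(l < j.+1) (l`!%:R : R)^-1 *: nabla r (nseq l s) x.

End Tensors.

Definition attained {R : realType} (A : set R) : Prop :=
  exists2 a, A a & lbound A a.

(* Vectors indexed by {1,...,q} are functions on nat of which only the values at
   1,...,q are used. *)
Definition in_unit {R : realType} (q : nat) (e : nat -> R) : Prop :=
  forall j, (1 <= j <= q)%N -> 0 < e j <= 1.

Section Models.
Context {R : realType} {n m : nat}.
Variables (p : nat) (F : set 'rV[R]_n).
Variables (f : 'rV[R]_n -> R) (c : 'rV[R]_n -> 'rV[R]_m) (h : 'rV[R]_m -> R).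
Implicit Types (x s d : 'rV[R]_n) (sigma delta : R).

Definition w x : R := f x + h (c x).

Definition taylor_w (j : nat) x d : R := taylor f j x d + h (taylor c j x d).

Definition taylor_w_values (j : nat) delta x : set R :=
  [set taylor_w j x d | d in [set d | F (x + d) /\ norm2 d <= delta]].

Definition phi_w (j : nat) delta x : R :=
  w x - inf (taylor_w_values j delta x).

Definition model x sigma s : R :=
  taylor_w p x s + sigma / p.+1`!%:R * norm2 s ^+ p.+1.

Definition taylor_model x sigma s (j : nat) d : R :=
  taylor (taylor f p x) j s d + h (taylor (taylor c p x) j s d)
  + sigma / p.+1`!%:R * taylor (fun s' => norm2 s' ^+ p.+1) j s d.

Definition taylor_model_values x sigma (j : nat) delta s : set R :=
  [set taylor_model x sigma s j d |
    d in [set d | F (x + s + d) /\ norm2 d <= delta]].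

Definition phi_model x sigma (j : nat) delta s : R :=
  model x sigma s - inf (taylor_model_values x sigma j delta s).

(* The minima in the definitions of [phi_w] and [phi_model], and that of the
   model over the feasible steps, exist at the iterate x with weight sigma; the
   infima above are then minima. *)
Definition minima_attained (q : nat) x sigma : Prop :=
  [/\ forall j delta, (1 <= j <= q)%N -> 0 < delta ->
        attained (taylor_w_values j delta x),
      forall j delta s, (1 <= j <= q)%N -> 0 < delta -> F (x + s) ->
        attained (taylor_model_values x sigma j delta s) &
      attained [set model x sigma s | s in [set s | F (x + s)]]].

End Models.

Section Assumptions.
Context {R : realType} {n m : nat}.
Variables (p : nat) (F : set 'rV[R]_n).
Variables (f : 'rV[R]_n -> R) (c : 'rV[R]_n -> 'rV[R]_m) (h : 'rV[R]_m -> R).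

(* [Lf 0] and [Lc 0] are fixed constants that only enter [Lw] below. *)
Definition AS1 (Lf : nat -> R) : Prop :=
  [/\ Cp p f, forall j, (j <= p)%N -> 1 <= Lf j &
      forall j, (1 <= j <= p)%N ->
        derivative_lipschitz (fun a : R => `|a|) F f j (Lf j)].

Definition AS2 (Lc : nat -> R) : Prop :=
  [/\ Cp p c, forall j, (j <= p)%N -> 1 <= Lc j &
      forall j, (1 <= j <= p)%N -> derivative_lipschitz norm2 F c j (Lc j)].

Definition AS3 (Lh : R) : Prop :=
  [/\ 0 <= Lh, forall x y, `|h x - h y| <= Lh * norm2 (x - y),
      forall x y, h (x + y) <= h x + h y & h 0 = 0].

Definition AS4 (wlow : R) : Prop := forall x, F x -> wlow <= w f c h x.

End Assumptions.

Definition convex_fun {R : realType} {m : nat} (h : 'rV[R]_m -> R) : Prop :=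
  convex_function [set: 'rV[R]_m] h.

Record params (R : realType) := Params {
  sigma0 : R; theta : R; sigma_min : R; eta1 : R; eta2 : R;
  gamma1 : R; gamma2 : R; gamma3 : R }.

Definition valid_params {R : realType} (a : params R) : Prop :=
  [/\ 0 < sigma0 a, 0 < theta a < 1, 0 < sigma_min a <= sigma0 a,
      [/\ 0 < eta1 a, eta1 a <= eta2 a & eta2 a < 1] &
      [/\ 0 < gamma1 a < 1, 1 < gamma2 a & gamma2 a < gamma3 a]].

(* x_k, sigma_k, delta_{k,j}, and the pair (s_k, delta_s) of a step and its
   radii computed at iteration k. The values after termination are irrelevant. *)
Record iterates (R : realType) (n : nat) := Iterates {
  it_x : nat -> 'rV[R]_n;
  it_sigma : nat -> R;
  it_delta : nat -> nat -> R;
  it_s : nat -> 'rV[R]_n;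
  it_deltas : nat -> nat -> R }.

Section Algorithm.
Context {R : realType} {n m : nat}.
Variables (p q : nat) (F : set 'rV[R]_n).
Variables (f : 'rV[R]_n -> R) (c : 'rV[R]_n -> 'rV[R]_m) (h : 'rV[R]_m -> R).
Variables (a : params R) (x0 : 'rV[R]_n) (eps : nat -> R) (z : iterates R n).
Implicit Types (x s : 'rV[R]_n) (k : nat).

Definition optimality_test (delta : nat -> R) x : Prop :=
  forall j, (1 <= j <= q)%N ->
    phi_w F f c h j (delta j) x <= eps j * delta j ^+ j / j`!%:R.

Definition admissible_pair x sigma s (deltas : nat -> R) : Prop :=
  [/\ s != 0, F (x + s), in_unit q deltas,
      model p f c h x sigma s <= model p f c h x sigma 0 &
      forall j, (1 <= j <= q)%N ->
        phi_model p F f c h x sigma j (deltas j) s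
          <= theta a * eps j * deltas j ^+ j / j`!%:R].

Definition rho k : R :=
  (w f c h (it_x z k) - w f c h (it_x z k + it_s z k)) /
  (w f c h (it_x z k) - taylor_w f c h p (it_x z k) (it_s z k)).

Definition successful k : bool := eta1 a <= rho k.

(* After an unsuccessful iteration the iterate is unchanged: the algorithm goes
   directly to the step computation, without evaluating derivatives and without
   applying the optimality test. *)
Definition new_iterate k : bool := if k is k'.+1 then successful k' else true.

(* Termination at iteration k, once reached: by the optimality test, or because
   there is no admissible pair. *)
Definition stops k : Prop :=
  (new_iterate k /\ optimality_test (it_delta z k) (it_x z k)) \/
  ~ (exists s deltas, admissible_pair (it_x z k) (it_sigma z k) s deltas).

Definition reached k : Prop := forall i, (i < k)%N -> ~ stops i.

Definition iteration k : Prop :=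
  [/\ admissible_pair (it_x z k) (it_sigma z k) (it_s z k) (it_deltas z k),
      it_x z k.+1 = (if successful k then it_x z k + it_s z k else it_x z k),
      forall j, (1 <= j <= q)%N ->
        it_delta z k.+1 j =
          (if successful k then it_deltas z k j else it_delta z k j) &
      [/\ eta2 a <= rho k ->
            Num.max (sigma_min a) (gamma1 a * it_sigma z k)
              <= it_sigma z k.+1 <= it_sigma z k,
          eta1 a <= rho k < eta2 a ->
            it_sigma z k <= it_sigma z k.+1 <= gamma2 a * it_sigma z k &
          rho k < eta1 a ->
            gamma2 a * it_sigma z k <= it_sigma z k.+1
              <= gamma3 a * it_sigma z k]].

Definition is_run : Prop :=
  [/\ it_x z 0%N = x0, it_sigma z 0%N = sigma0 a, in_unit q (it_delta z 0%N) &
      forall k, reached k.+1 -> iteration k].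

Definition run_minima_attained : Prop :=
  forall k, reached k ->
    minima_attained p F f c h q (it_x z k) (it_sigma z k).

Definition terminates_at k : Prop := reached k /\ stops k.

(* Evaluations of f and c up to termination at iteration k: one at x_0 and one
   at x_i + s_i for each of the iterations i = 0, ..., k-1. *)
Definition function_evaluations k : nat := k.+1.

(* Every new iterate counts as one evaluation of all the derivatives, also the
   final one, where the orders q+1, ..., p need not be evaluated. *)
Definition derivative_evaluations k : nat :=
  count new_iterate (iota 0 k.+1).

Definition good_case : Prop :=
  convex_set F /\
  (((forall y, h y = 0) /\ (q = 1%N \/ q = 2%N)) \/ (convex_fun h /\ q = 1%N)).

Variables (Lf Lc : nat -> R) (Lh : R).

Definition Lw : R :=
  \big[Num.max/Lf 0%N + Lh * Lc 0%N]_(1 <= j < p.+1)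
    (Lf j.-1 + Lh * Lc j.-1).

Definition Lwp : R := Lf p + Lh * Lc p.

Definition sigma_max : R :=
  Num.max (sigma0 a) (gamma3 a * Lwp / (1 - eta2 a)).

Definition kappa_delta_min : R :=
  theta a / (2 * q`!%:R * (6 * Lw + 3 * sigma_max)).

Definition xi : R :=
  ((1 - theta a) / (3 * q`!%:R * (Lwp + sigma_max)))
    `^ ((p - q + 1)%N%:R)^-1.

Definition radius_rule : Prop :=
  (good_case ->
     (forall j, (1 <= j <= q)%N -> it_delta z 0%N j = 1) /\
     (forall k, reached k.+1 ->
        forall j, (1 <= j <= q)%N -> it_deltas z k j = 1)) /\
  (~ good_case ->
     forall k, reached k.+1 -> norm2 (it_s z k) <= xi ->
       forall j, (1 <= j <= q)%N ->
         kappa_delta_min * eps j <= it_deltas z k j).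

End Algorithm.

(* For 1 <= q, the initial values are terms of the min and of the max. *)
Definition min_eps {R : realType} (q : nat) (eps : nat -> R) : R :=
  \big[Num.min/eps 1%N ^+ 2]_(1 <= j < q.+1) eps j ^+ j.+1.

Definition max_eps_inv {R : realType} (q : nat) (eps : nat -> R) : R :=
  \big[Num.max/eps 1%N ^- 2]_(1 <= j < q.+1) eps j ^- j.+1.

(* Main.v *)
Require Import Defs.
From mathcomp Require Import all_boot all_order all_algebra.
From mathcomp Require Import all_classical all_reals all_analysis.
From mathcomp Require Import ring lra.
Import Order.TTheory GRing.Theory Num.Theory.
Import numFieldNormedType.Exports.
Local Open Scope classical_set_scope.
Local Open Scope ring_scope.

Set Implicit Arguments.
Unset Strict Implicit.
Unset Printing Implicit Defensive.

(** The complexity bound is a decrease argument. A successful iteration decreases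
    w by at least a multiple of |s_k|^(p+1), because the accepted step does not
    increase the regularized model and sigma_k >= sigma_min. So it suffices to
    bound |s_k| from below when the optimality test fails at x_k + s_k, and to
    bound the number of unsuccessful iterations by that of the successful ones.

    Model errors. Along a line every function becomes a function of one real
    variable, and its derivatives in the direction of the line become ordinary
    derivatives ([nabla_line]). Taylor's theorem in one variable, with the
    Lipschitz bound on the derivative of order p, gives an error O(|s|^(p+1)) for
    the Taylor models of f and of each coordinate of c ([taylor_error]), hence for
    the model of w, since h is Lipschitz ([objective_error]). The derivatives of
    the models in s have to be compared with those of f and c at x + s. In
    direction d both expansions are polynomials in t of degree at most p, and both
    are close to the same function at x + s + t d; since the coefficients of a
    polynomial of bounded degree are controlled by its values on a segment
    ([coef_le_sup0r]), the expansions are close term by term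
    ([taylor_model_error]). Derivatives of |s|^(p+1) are controlled by
    homogeneity ([normpow_derive_le]). Altogether ([phi_w_le_phi_model]) the
    measure of order j of w at x + s exceeds that of the model at s by at most
    O(|s|^(p+1) + |s|^(p+1-j) delta^j).

    Step bounds. If the test of order j fails at x_k + s_k, this excess is at
    least a multiple of eps_j delta_j^j. In the convex case delta = 1 and j = 1,
    and eps_1 = O(|s_k|^p). Otherwise delta_j is at least of the order of eps_j or
    |s_k| is bounded below, and eps_j^(j+1) = O(|s_k|^(p+1)). These are
    [step_lower_bound1] and [step_lower_bound].

    Counting. If sigma_k is large enough, the step is very successful; so sigma_k
    is bounded ([sigma_le]), and unsuccessful iterations, each of which increases
    sigma_k by a fixed factor, are at most proportional to the successful ones, up
    to a constant ([iterations_le]). A finite number of iterations follows, and the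
    algorithm terminates ([complexity]).

    Accuracy. Termination by the optimality test gives the claim at once. If there
    is no admissible pair, then s = 0 minimizes the model, since a nonzero
    minimizer would form an admissible pair with small radii; and then the measure
    of order j of w at x_k with radius delta is O(delta^(j+1)), so that small radii
    satisfy the test ([phi_w_small]). In the convex case the radius can be enlarged
    to one by convexity ([phi_w_small1]). *)

(** * The Euclidean norm *)

Section EuclideanNorm.
Context {R : realType} {n : nat}.
Implicit Types x y : 'rV[R]_n.

Lemma norm2_ge0 x : 0 <= norm2 x.
Proof. exact: sqrtr_ge0. Qed.

Lemma sqr_norm2 x : norm2 x ^+ 2 = \sum_(i < n) x 0 i ^+ 2.
Proof. by rewrite sqr_sqrtr// sumr_ge0// => i _; exact: sqr_ge0. Qed.

Lemma norm2_eq0 x : (norm2 x == 0) = (x == 0).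
Proof.
rewrite -sqrf_eq0 sqr_norm2; apply/eqP/eqP => [/psumr_eq0P x0|->].
  apply/rowP => i; rewrite mxE; apply/eqP; rewrite -sqrf_eq0; apply/eqP.
  by apply: x0 => // j _; exact: sqr_ge0.
by rewrite big1// => i _; rewrite mxE expr0n.
Qed.

Lemma norm2_gt0 x : (0 < norm2 x) = (x != 0).
Proof. by rewrite lt0r norm2_ge0 andbT norm2_eq0. Qed.

Lemma norm20 : norm2 (0 : 'rV[R]_n) = 0.
Proof. by apply/eqP; rewrite norm2_eq0. Qed.

Lemma norm2Z a x : norm2 (a *: x) = `|a| * norm2 x.
Proof.
rewrite /norm2 -sqrtr_sqr -sqrtrM ?sqr_ge0//; congr Num.sqrt.
by rewrite mulr_sumr; apply: eq_bigr => i _; rewrite mxE exprMn.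
Qed.

Lemma norm2N x : norm2 (- x) = norm2 x.
Proof. by rewrite -scaleN1r norm2Z normrN1 mul1r. Qed.

Lemma coord_le_norm2 x i : `|x 0 i| <= norm2 x.
Proof.
rewrite -(@ler_pXn2r _ 2)// ?nnegrE ?norm2_ge0// sqr_norm2 real_normK ?num_real//.
by rewrite (bigD1 i)//= lerDl sumr_ge0// => j _; exact: sqr_ge0.
Qed.

Definition dot x y : R := \sum_(i < n) x 0 i * y 0 i.

Lemma cauchy_schwarz x y : `|dot x y| <= norm2 x * norm2 y.
Proof.
have [->|y0] := eqVneq y 0.
  by rewrite norm20 mulr0 /dot big1 ?normr0// => i _; rewrite mxE mulr0.
have C0 : 0 < norm2 y ^+ 2 by rewrite exprn_gt0// norm2_gt0.
rewrite -(@ler_pXn2r _ 2)// ?nnegrE ?mulr_ge0 ?norm2_ge0//.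
rewrite real_normK ?num_real// exprMn -subr_ge0 -(pmulr_rge0 _ C0).
suff -> : norm2 y ^+ 2 * (norm2 x ^+ 2 * norm2 y ^+ 2 - dot x y ^+ 2) =
    \sum_(i < n) (x 0 i * norm2 y ^+ 2 - y 0 i * dot x y) ^+ 2.
  by rewrite sumr_ge0// => i _; exact: sqr_ge0.
under eq_bigr => i _.
  rewrite (_ : _ ^+ 2 = (x 0 i ^+ 2) * norm2 y ^+ 2 ^+ 2 -
    (x 0 i * y 0 i) * (2 * norm2 y ^+ 2 * dot x y) +
    (y 0 i ^+ 2) * dot x y ^+ 2); last by ring.
  over.
rewrite big_split sumrB/= -!mulr_suml -!sqr_norm2 -/(dot x y); ring.
Qed.

Lemma ler_norm2D x y : norm2 (x + y) <= norm2 x + norm2 y.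
Proof.
rewrite -(@ler_pXn2r _ 2)// ?nnegrE ?addr_ge0 ?norm2_ge0//.
have -> : norm2 (x + y) ^+ 2 = norm2 x ^+ 2 + 2 * dot x y + norm2 y ^+ 2.
  rewrite !sqr_norm2 /dot mulr_sumr -!big_split/=.
  by apply: eq_bigr => i _; rewrite mxE; ring.
have := le_trans (ler_norm _) (cauchy_schwarz x y); nra.
Qed.

Lemma norm2_le_coord x M : 0 <= M -> (forall i, `|x 0 i| <= M) ->
  norm2 x <= n%:R * M.
Proof.
move=> M0 xM; rewrite -(@ler_pXn2r _ 2)// ?nnegrE ?norm2_ge0 ?mulr_ge0//.
rewrite sqr_norm2; apply: (@le_trans _ _ (\sum_(i < n) M ^+ 2)).
  apply: ler_sum => i _; rewrite -real_normK ?num_real//.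
  by rewrite ler_pXn2r ?nnegrE.
rewrite sumr_const card_ord exprMn -(mulr_natl (M ^+ 2)) ler_wpM2r ?sqr_ge0// -natrX.
by rewrite ler_nat; case: (n) => // k; rewrite expnS leq_pmulr// expn1.
Qed.

End EuclideanNorm.

(** * Polynomials of bounded degree on the unit interval *)

Section Interpolation.
Context {R : realType}.
Implicit Types P : {poly R}.

Lemma coef_comp_poly_scale P a i : (P \Po (a *: 'X))`_i = a ^+ i * P`_i.
Proof.
rewrite comp_polyE coef_sum; under eq_bigr do rewrite exprZn !coefZ coefXn.
have [iP|Pi] := ltnP i (size P).
  rewrite (bigD1 (Ordinal iP))//= eqxx big1 ?addr0 ?mulr1 1?mulrC// => j ji.
  by rewrite (_ : (i == j) = false) ?mulr0//; apply/negbTE; rewrite eq_sym.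
rewrite nth_default// mulr0 big1// => j _.
by rewrite gtn_eqF ?mulr0// (leq_trans (ltn_ord j)).
Qed.

(** On polynomials of bounded degree, the largest coefficient is controlled by
    the supremum over [0, 1]. The combination P(t/2) - 2^-k P(t) is again bounded
    on [0, 1] and lacks the monomial of degree k, so that the degree can be
    lowered by one at the cost of a factor depending on k only. *)
Lemma coef_le_sup01 (k : nat) : exists2 C : R, 0 <= C &
  forall P (M : R), (size P <= k.+1)%N ->
    (forall t : R, 0 <= t <= 1 -> `|P.[t]| <= M) -> forall i, `|P`_i| <= C * M.
Proof.
elim: k => [|k [C C0 IH]].
  exists 1 => // P M sP PM [|i].
    by rewrite mul1r -horner_coef0; apply: PM; rewrite lexx ler01.
  rewrite nth_default ?normr0 ?mul1r; last by rewrite (leq_trans sP).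
  by apply: le_trans (PM 0 _) => //; rewrite lexx ler01.
have h0 : 0 <= 2^-1 :> R by rewrite invr_ge0.
have h1 : 2^-1 <= 1 :> R by rewrite invf_le1// ler1n.
pose a : R := 2^-1 ^+ k.+1.
have a0 : 0 < a by rewrite exprn_gt0 ?invr_gt0.
pose D : R := C * 2 / a.
have D0 : 0 <= D by apply: divr_ge0; [exact: mulr_ge0|exact: ltW].
have D1 : 0 <= 1 + k.+1%:R * D.
  by apply: addr_ge0; [exact: ler01|exact: mulr_ge0].
exists (D + (1 + k.+1%:R * D)); first exact: addr_ge0.
move=> P M sP PM.
have M0 : 0 <= M by apply: le_trans (PM 0 _); rewrite ?lexx ?ler01.
have lo i : (i < k.+1)%N -> `|P`_i| <= D * M.
  move=> ik; pose Q := P \Po (2^-1 *: 'X) - a *: P.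
  have Qi j : Q`_j = (2^-1 ^+ j - a) * P`_j.
    by rewrite coefB coefZ mulrBl; congr (_ - _); rewrite coef_comp_poly_scale.
  have sQ : (size Q <= k.+1)%N.
    apply/leq_sizeP => j; rewrite leq_eqVlt => /predU1P[<-|kj].
      by rewrite Qi subrr mul0r.
    by rewrite Qi nth_default ?mulr0// (leq_trans sP).
  have QM (t : R) : 0 <= t <= 1 -> `|Q.[t]| <= 2 * M.
    move=> t01; have /andP[t0 t1] := t01.
    rewrite hornerD hornerN !hornerZ horner_comp hornerZ hornerX.
    rewrite (_ : 2 * M = M + M); last by ring.
    rewrite (le_trans (ler_normB _ _))// lerD//.
      by apply: PM; apply/andP; split; lra.
    rewrite normrM (ger0_norm (ltW a0)); apply: le_trans (PM _ t01).
    by rewrite ler_piMl// /a exprn_ile1.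
  have := IH Q (2 * M) sQ QM i; rewrite Qi normrM.
  have ai : a <= `|2^-1 ^+ i - a|.
    rewrite ger0_norm /a; last first.
      by rewrite subr_ge0 ler_wiXn2l// ltnW.
    rewrite lerBrDr exprS -mulrDl (_ : 2^-1 + 2^-1 = 1) ?mul1r; last by field.
    by rewrite ler_wiXn2l// -ltnS.
  move=> h; rewrite /D mulrAC ler_pdivlMr// mulrC.
  by rewrite (le_trans (ler_wpM2r (normr_ge0 _) ai))// (le_trans h)// mulrA.
move=> i; case: (ltngtP i k.+1) => [ik|ik|->].
- by apply: le_trans (lo _ ik) _; rewrite ler_wpM2r// lerDl.
- rewrite nth_default; last by rewrite (leq_trans sP).
  by rewrite normr0; apply: mulr_ge0 => //; exact: addr_ge0.
have P1 : P`_k.+1 = P.[1] - \sum_(j < k.+1) P`_j.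
  rewrite (horner_coef_wide _ sP) big_ord_recr/= expr1n mulr1.
  under eq_bigr do rewrite expr1n mulr1.
  by rewrite addrAC subrr add0r.
rewrite P1 (le_trans (ler_normB _ _))//.
apply: (@le_trans _ _ ((1 + k.+1%:R * D) * M)); last first.
  by rewrite ler_wpM2r// lerDr.
rewrite mulrDl mul1r lerD//; first by apply: PM; rewrite ler01 lexx.
rewrite (le_trans (ler_norm_sum _ _ _))//.
apply: (@le_trans _ _ (\sum_(j < k.+1) D * M)).
  by apply: ler_sum => j _; exact: lo.
by rewrite sumr_const card_ord -mulrA mulr_natl.
Qed.

(** Rescaling the variable: a bound on [0, r] costs a factor r^-i on the
    coefficient of degree i. *)
Lemma coef_le_sup0r (k : nat) : exists2 C : R, 0 <= C &
  forall P (M r : R), 0 <= r -> (size P <= k.+1)%N ->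
    (forall t : R, 0 <= t <= r -> `|P.[t]| <= M) ->
    forall i, `|P`_i| * r ^+ i <= C * M.
Proof.
have [C C0 hC] := coef_le_sup01 k; exists C => // P M r r0 sP PM i.
have := hC (P \Po (r *: 'X)) M _ _ i.
rewrite coef_comp_poly_scale normrM normrX (ger0_norm r0) mulrC; apply.
  apply/leq_sizeP => j kj.
  by rewrite coef_comp_poly_scale nth_default ?mulr0// (leq_trans sP).
move=> t /andP[t0 t1]; rewrite horner_comp !hornerE; apply: PM.
by rewrite mulr_ge0//= ler_piMr.
Qed.

End Interpolation.

(** * Taylor expansion along a line *)

Section Lines.
Context {R : realType} {n : nat}.
Implicit Types (x s d v : 'rV[R]_n) (P : {poly R}).

Lemma derive_line (W : normedModType R) (g : 'rV[R]_n -> W) x v t :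
  'D_v g (x + t *: v) = ((fun u : R => g (x + u *: v))^`() t)%classic.
Proof.
rewrite /derive /derive1; set D := (fun _ : R => _); set D' := (fun _ : R => _).
by suff -> : D = D' by []; apply/funext => u; rewrite /D /D' /= addrCA -scalerDl.
Qed.

Lemma nabla_line (W : normedModType R) (g : 'rV[R]_n -> W) l x v t :
  nabla g (nseq l v) (x + t *: v) =
  ((fun u : R => g (x + u *: v))^`(l) t)%classic.
Proof.
elim: l t => [//|l IH] t; rewrite derive1nS.
transitivity ((fun u : R => nabla g (nseq l v) (x + u *: v))^`() t)%classic.
  exact: derive_line.
by congr (derive1 _ t); apply/funext => u; exact: IH.
Qed.

Lemma derivable_line (W : normedModType R) (g : 'rV[R]_n -> W) x v t :
  derivable g (x + t *: v) v -> derivable (fun u : R => g (x + u *: v)) t 1.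
Proof.
rewrite /derivable; set D := (fun _ : R => _ *: _); set D' := (fun _ : R => _ *: _).
suff -> : D = D' by []; apply/funext => u; rewrite /D /D' /= addrCA -scalerDl.
by rewrite -[u%:A]/(u * 1) mulr1.
Qed.

Lemma horner_derive1n P l : ((horner P)^`(l))%classic = horner (P^`(l)).
Proof. by elim: l => [//|l IH]; rewrite derive1nS IH derivnS derivE. Qed.

Definition taylor_poly (phi : R -> R) j : {poly R} :=
  \poly_(l < j.+1) ((phi^`(l) 0)%classic / l`!%:R).

Lemma deriv_taylor_poly phi j :
  (taylor_poly phi j.+1)^`() = taylor_poly (phi^`()%classic) j.
Proof.
apply/polyP => i; rewrite coef_deriv !coef_poly ltnS.
case: ifP => ij; last by rewrite mul0rn.
rewrite -derive1Sn factS natrM invfM -[LHS]mulr_natr.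
by rewrite mulrA mulrAC divfK// pnatr_eq0.
Qed.

(** The mean value theorem carries a bound on the remainder of the derivative to
    the function, so that the oscillation of the derivative of top order bounds
    the remainder. *)
Lemma taylor_remainder (phi : R -> R) j (M : R) :
  (forall l (t : R), (l < j)%N -> 0 <= t <= 1 -> derivable (phi^`(l))%classic t 1) ->
  (forall t : R, 0 <= t <= 1 -> `|(phi^`(j) t)%classic - (phi^`(j) 0)%classic| <= M) ->
  forall t : R, 0 <= t <= 1 -> `|phi t - (taylor_poly phi j).[t]| <= M.
Proof.
elim: j phi => [|j IH] phi dphi phiM t t01.
  rewrite (_ : _.[t] = phi 0) ?phiM//.
  by rewrite /taylor_poly poly_def big_ord1 fact0 divr1 expr0 alg_polyC hornerC.
have /andP[t0 t1] := t01.
have IH' (u : R) : 0 <= u <= 1 ->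
    `|(phi^`() u)%classic - (taylor_poly (phi^`()%classic) j).[u]| <= M.
  apply: IH => [l v lj v01|v v01]; first by rewrite -derive1Sn; exact: dphi.
  by rewrite -!derive1Sn; exact: phiM.
pose e : R -> R := phi - horner (taylor_poly phi j.+1).
have de (u : R) : 0 <= u <= 1 -> is_derive u 1 e
    ((phi^`() u)%classic - (taylor_poly (phi^`()%classic) j).[u]).
  move=> u01; apply: is_deriveB; last first.
    by rewrite -deriv_taylor_poly; exact: is_derive_poly.
  by rewrite derive1E; apply/derivableP; apply: (dphi 0%N).
have de' (u : R) : u \in `]0, t[ -> is_derive u 1 e
    ((phi^`() u)%classic - (taylor_poly (phi^`()%classic) j).[u]).
  rewrite in_itv/= => /andP[u0 ut]; apply: de.
  by rewrite (ltW u0)/= (le_trans (ltW ut)).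
have ce : {within `[0, t], continuous e}.
  apply: derivable_within_continuous => u; rewrite in_itv/= => /andP[u0 ut].
  by apply: ex_derive; apply: de; rewrite u0/= (le_trans ut).
have [u] := MVT_segment t0 de' ce.
rewrite in_itv/= => /andP[u0 ut].
have -> : e 0 = 0.
  rewrite -[LHS]/(phi 0 - (taylor_poly phi j.+1).[0]) horner_coef0 coef_poly/=.
  by rewrite fact0 divr1 subrr.
rewrite !subr0 => et.
have u01 : 0 <= u <= 1 by rewrite u0 (le_trans ut).
rewrite -[X in `|X|]/(e t) et normrM (ger0_norm t0).
have M0 : 0 <= M by exact: le_trans (IH' _ u01).
by apply: (le_trans _ (IH' _ u01)); rewrite ler_piMr.
Qed.

Lemma horner_taylor_poly (g : 'rV[R]_n -> R) j x v t :
  (taylor_poly (fun u => g (x + u *: v)) j).[t] =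
  \sum_(l < j.+1) nabla g (nseq l v) x / l`!%:R * t ^+ l.
Proof.
rewrite /taylor_poly poly_def horner_sum; apply: eq_bigr => l _.
by rewrite hornerZ hornerXn -nabla_line scale0r addr0.
Qed.

(** When g is polynomial along the line from s in direction d, so are all its
    derivatives in direction d. *)
Lemma taylor_horner (g : 'rV[R]_n -> R) s d P j :
  (forall t, g (s + t *: d) = P.[t]) ->
  taylor g j s d = \sum_(l < j.+1) P`_l.
Proof.
move=> gP; apply: eq_bigr => l _.
have := nabla_line g l s d 0; rewrite scale0r addr0 => ->.
rewrite (_ : (fun u => _) = horner P); last exact/funext.
rewrite horner_derive1n horner_coef0 coef_derivn addn0 ffactnn.
by rewrite -[LHS]/(_ * _) -[X in _ * X]mulr_natr mulrC mulfK// pnatr_eq0 -lt0n fact_gt0.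
Qed.

End Lines.

(** * Derivatives as multilinear forms *)

Section Multilinear.
Context {R : realType} {n : nat}.
Implicit Types (x s d u v w : 'rV[R]_n) (vs us : seq 'rV[R]_n) (P : {poly R}).

(** Differentiability of the derivatives of order less than k is what makes the
    derivatives of order up to k multilinear in the directions. *)
Definition diffn (W : normedModType R) k (g : 'rV[R]_n -> W) :=
  forall vs, (size vs < k)%N -> forall x, differentiable (nabla g vs) x.

Section General.
Context {W : normedModType R}.
Implicit Types g : 'rV[R]_n -> W.

Lemma nabla_cat g us vs : nabla g (us ++ vs) = nabla (nabla g vs) us.
Proof. exact: foldr_cat. Qed.

Lemma diffnW g k l : (k <= l)%N -> diffn l g -> diffn k g.
Proof. by move=> kl dg vs sv; apply: dg; exact: leq_trans kl. Qed.

Lemma diffn_nabla g k vs : diffn (k + size vs) g -> diffn k (nabla g vs).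
Proof.
move=> dg us su x; rewrite -nabla_cat; apply: dg.
by rewrite size_cat ltn_add2r.
Qed.

Lemma derive_lin g x : differentiable g x ->
  forall t u v, 'D_(u + t *: v) g x = 'D_u g x + t *: 'D_v g x.
Proof. by move=> dg t u v; rewrite !deriveE// linearD linearZ. Qed.

Lemma nablaDZ (a b : 'rV[R]_n -> W) t vs : diffn (size vs) a -> diffn (size vs) b ->
  nabla (fun x => a x + t *: b x) vs = fun x => nabla a vs x + t *: nabla b vs x.
Proof.
elim: vs => [//|v vs IH] da db; apply/funext => x.
rewrite -[LHS]/('D_v (nabla _ vs) x) IH; [|exact: diffnW da|exact: diffnW db].
have dera : derivable (nabla a vs) x v by exact/diff_derivable/da.
have derb : derivable (nabla b vs) x v by exact/diff_derivable/db.
rewrite -[LHS]/('D_v (nabla a vs + t \*: nabla b vs) x).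
by rewrite deriveD// ?deriveZ//; exact: derivableZ.
Qed.

Lemma nablaZ (a : R) g l v : diffn l g ->
  nabla g (nseq l (a *: v)) = fun x => a ^+ l *: nabla g (nseq l v) x.
Proof.
elim: l => [|l IH] dg; apply/funext => x; first by rewrite expr0 scale1r.
rewrite -[LHS]/('D_(a *: v) (nabla _ _) x) IH; last exact: diffnW dg.
have dgv : differentiable (nabla g (nseq l v)) x by apply: dg; rewrite size_nseq.
rewrite -[LHS]/('D_(a *: v) (a ^+ l \*: nabla g (nseq l v)) x).
rewrite deriveZ; last exact: diff_derivable.
rewrite -[a *: v]add0r derive_lin// derive0 add0r scalerA -exprSr.
by [].
Qed.

End General.

Lemma nabla_sum N (a : 'I_N -> R) (g : 'I_N -> 'rV[R]_n -> R) vs :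
  (forall i, diffn (size vs) (g i)) ->
  nabla (fun x => \sum_i a i * g i x) vs =
  fun x => \sum_i a i * nabla (g i) vs x.
Proof.
elim: vs => [//|v vs IH] dg; apply/funext => x.
rewrite -[LHS]/('D_v (nabla _ vs) x) IH => [|i]; last exact: diffnW (dg i).
rewrite (_ : (fun x => _) = \sum_i (a i \*: nabla (g i) vs)); last first.
  by apply/funext => y; rewrite fct_sumE.
have dgx i : derivable (nabla (g i) vs) x v by apply/diff_derivable/dg.
rewrite derive_sum => [|i]; last exact: derivableZ.
by apply: eq_bigr => i _; rewrite deriveZ.
Qed.

(** A multilinear form is bounded: expand the innermost direction in the canonical
    basis, and apply the bound to the partial derivatives of g. *)
Lemma nabla_bound k (g : 'rV[R]_n -> R) x : diffn k g ->
  exists2 M : R, 0 <= M & forall vs, size vs = k ->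
    `|nabla g vs x| <= M * \prod_(v <- vs) norm2 v.
Proof.
elim: k g => [|k IH] g dg.
  by exists `|g x| => // -[|//] _; rewrite big_nil mulr1.
have dgi i : diffn k ('D_(delta_mx 0 i) g : 'rV[R]_n -> R).
  by apply: (@diffn_nabla _ g k [:: delta_mx 0 i]); rewrite addn1.
have /choice[M hM] : forall i, exists M : R, 0 <= M /\ forall vs, size vs = k ->
    `|nabla ('D_(delta_mx 0 i) g) vs x| <= M * \prod_(v <- vs) norm2 v.
  by move=> i; have [M M0 hM] := IH _ (dgi i); exists M.
exists (\sum_(i < n) M i); first by apply: sumr_ge0 => i _; case: (hM i).
move=> vs; case/lastP: vs => [//|vs v]; rewrite size_rcons => -[sk].
rewrite -cats1 nabla_cat.
have -> : nabla g [:: v] = fun y => \sum_i v 0 i * 'D_(delta_mx 0 i) g y.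
  apply/funext => y; rewrite -[LHS]/('D_v g y).
  have dgy : differentiable g y by exact: (dg [::]).
  rewrite deriveE// [X in 'd g y X]row_sum_delta linear_sum/=.
  by apply: eq_bigr => i _; rewrite linearZ deriveE.
rewrite nabla_sum ?sk// (le_trans (ler_norm_sum _ _ _))// big_cat big_seq1/=.
rewrite mulr_suml; apply: ler_sum => i _; rewrite normrM mulrC.
rewrite mulrA ler_pM//; first by case: (hM i) => _; exact.
exact: coord_le_norm2.
Qed.

(** The form of order l on the diagonal is a polynomial along each line. The
    expansion splits the direction s + t d at the innermost derivative, where this
    is linearity of the differential at every point at once; the directions that
    are already split accumulate in vs. The coefficients are bounded by powers of
    |d| only, with |s| in the constant. *)
Lemma nabla_poly (g : 'rV[R]_n -> R) p x s (A : R) :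
  diffn p g -> 1 <= A -> norm2 s <= A ->
  exists2 M : R, 0 <= M & forall d l vs, (l + size vs <= p)%N ->
  exists P, [/\ (size P <= l.+1)%N,
    forall t, nabla g (nseq l (s + t *: d) ++ vs) x = P.[t] &
    forall i, `|P`_i| <=
      (2 * A) ^+ l * M * norm2 d ^+ i * \prod_(v <- vs) norm2 v].
Proof.
move=> dg A1 sA.
have /choice[M hM] : forall k, exists M : R, 0 <= M /\ ((k <= p)%N ->
    forall vs, size vs = k -> `|nabla g vs x| <= M * \prod_(v <- vs) norm2 v).
  move=> k; have [kp|pk] := leqP k p; last by exists 0.
  by have [M M0 hM] := nabla_bound x (diffnW kp dg); exists M.
have pr0 vs : 0 <= \prod_(v <- vs) norm2 v.
  by apply: prodr_ge0 => v _; exact: norm2_ge0.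
have MM k : (k <= p)%N -> M k <= \sum_(i < p.+1) M i.
  rewrite -ltnS => kp; rewrite (bigD1 (Ordinal kp))//= lerDl.
  by apply: sumr_ge0 => i _; case: (hM i).
have SM0 : 0 <= \sum_(i < p.+1) M i.
  by apply: sumr_ge0 => i _; case: (hM i).
exists (\sum_(i < p.+1) M i) => // d.
elim=> [|l IH] vs lp.
  exists (nabla g vs x)%:P; split; first by rewrite size_polyC; case: (_ == _).
    by move=> t; rewrite hornerC.
  move=> [|i]; rewrite coefC/=.
    rewrite expr0 expr0 mul1r mulr1; case: (hM (size vs)) => _ /(_ lp vs erefl).
    by move/le_trans; apply; rewrite ler_wpM2r// MM.
  by rewrite normr0 !mulr_ge0// exprn_ge0// ?norm2_ge0// mulr_ge0// (le_trans _ A1).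
have [|P1 [sP1 P1E P1M]] := IH (s :: vs); first by rewrite /= addnS -addSn.
have [|P2 [sP2 P2E P2M]] := IH (d :: vs); first by rewrite /= addnS -addSn.
exists (P1 + 'X * P2); split.
- rewrite (leq_trans (size_polyD _ _))// geq_max (leq_trans sP1)//=.
  have [->|P20] := eqVneq P2 0; first by rewrite mulr0 size_poly0.
  by rewrite mulrC size_mulX.
- move=> t; rewrite hornerD hornerM hornerX -P1E -P2E.
  rewrite -[l.+1]addn1 nseqD -catA !nabla_cat.
  have dvs y : differentiable (nabla g vs) y.
    by apply: dg; rewrite (leq_trans _ lp)// addSn ltnS leq_addl.
  rewrite (_ : nabla (nabla g vs) (nseq 1 _) = fun y =>
     nabla g (s :: vs) y + t *: nabla g (d :: vs) y); last first.
    by apply/funext => y; exact: derive_lin.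
  rewrite nablaDZ//; apply: diffn_nabla; apply: diffnW dg;
    by rewrite size_nseq/= addnS.
- set B := _ * \sum_(i < _) _ in P1M P2M *.
  have B0 : 0 <= (2 * A) ^+ l * \sum_(i < p.+1) M i.
    by rewrite mulr_ge0// exprn_ge0// mulr_ge0// (le_trans _ A1).
  move=> i; rewrite coefD (le_trans (ler_normD _ _))// exprS.
  set C := norm2 d ^+ i * \prod_(v <- vs) norm2 v.
  have C0 : 0 <= C by rewrite mulr_ge0// exprn_ge0// norm2_ge0.
  set E := (2 * A) ^+ l * (\sum_(i < p.+1) M i) in B0 *.
  have -> : 2 * A * (2 * A) ^+ l * (\sum_(i < p.+1) M i) * norm2 d ^+ i *
      \prod_(v <- vs) norm2 v = E * C * A + E * C * A by rewrite /E /C; ring.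
  apply: lerD.
    apply: le_trans (P1M i) _; rewrite big_cons -/E.
    have -> : E * norm2 d ^+ i * (norm2 s * \prod_(v <- vs) norm2 v) =
      E * C * norm2 s by rewrite /C; ring.
    by rewrite ler_wpM2l// mulr_ge0.
  rewrite coefXM; case: i => [|i] in C C0 *.
    by rewrite normr0; apply: mulr_ge0; [exact: mulr_ge0|exact: le_trans A1].
  apply: le_trans (P2M i) _; rewrite big_cons -/E.
  have -> : E * norm2 d ^+ i * (norm2 d * \prod_(v <- vs) norm2 v) =
    E * C * 1 by rewrite /C exprS; ring.
  by rewrite ler_wpM2l// mulr_ge0.
Qed.

End Multilinear.

(** * Accuracy of the Taylor models *)

Section TaylorError.
Context {R : realType} {n : nat}.
Implicit Types (x s d v : 'rV[R]_n) (g : 'rV[R]_n -> R) (U : set 'rV[R]_n).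

Lemma convex_set_line U x s (t : R) : convex_set U -> U x -> U (x + s) ->
  0 <= t <= 1 -> U (x + t *: s).
Proof.
move=> cU Ux Uxs /andP[t0 t1].
have := cU (x + s) x (Itv01 t0 t1); rewrite !inE => /(_ Uxs Ux).
rewrite /conv/= /unstable.onem scalerBl scale1r scalerDr.
by congr U; rewrite addrAC addrCA subrr addr0 addrC.
Qed.

Lemma horner_taylor g j x s t : diffn j g ->
  (taylor_poly (fun u => g (x + u *: s)) j).[t] = taylor g j x (t *: s).
Proof.
move=> dg; rewrite horner_taylor_poly; apply: eq_bigr => l _.
rewrite (@nablaZ R n R t g l s); last by apply: diffnW dg; rewrite -ltnS.
by rewrite -[RHS]/(_ * (_ * _)) mulrAC [LHS]mulrC; congr (_ * _); exact: mulrC.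
Qed.

(** The oscillation of the p-th derivative along the step, by homogeneity at most
    |s|^p times L |s|, bounds the remainder. *)
Lemma taylor_error g p U (L : R) : diffn p g -> convex_set U -> 0 <= L ->
  (forall x y v, U x -> U y -> norm2 v = 1 ->
    `|nabla g (nseq p v) x - nabla g (nseq p v) y| <= L * norm2 (x - y)) ->
  forall x s, U x -> U (x + s) ->
    `|g (x + s) - taylor g p x s| <= L * norm2 s ^+ p.+1.
Proof.
move=> dg cU L0 gL x s Ux Uxs.
pose phi (u : R) := g (x + u *: s).
have phiE l u : (phi^`(l) u)%classic = nabla g (nseq l s) (x + u *: s).
  by rewrite nabla_line.
have dphi l (t : R) : (l < p)%N -> 0 <= t <= 1 -> derivable (phi^`(l))%classic t 1.
  move=> lp _; rewrite (_ : (phi^`(l))%classic = fun u => nabla g (nseq l s) (x + u *: s)).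
    by apply: derivable_line; apply: diff_derivable; apply: dg; rewrite size_nseq.
  exact/funext.
have phiM (t : R) : 0 <= t <= 1 ->
    `|(phi^`(p) t)%classic - (phi^`(p) 0)%classic| <= L * norm2 s ^+ p.+1.
  move=> t01; have /andP[t0 t1] := t01; rewrite !phiE scale0r addr0.
  have [->|s0] := eqVneq s 0.
    by rewrite scaler0 addr0 subrr normr0 mulr_ge0// exprn_ge0// norm2_ge0.
  have ns0 : 0 < norm2 s by rewrite norm2_gt0.
  pose s' := (norm2 s)^-1 *: s.
  have sE : s = norm2 s *: s' by rewrite scalerA mulfV ?scale1r// gt_eqF.
  have nE y : nabla g (nseq p s) y = norm2 s ^+ p * nabla g (nseq p s') y.
    by rewrite {1}sE (@nablaZ R n R _ g p).
  rewrite !nE -mulrBr normrM.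
  rewrite ger0_norm ?exprn_ge0 ?norm2_ge0//.
  rewrite mulrC exprS mulrA ler_wpM2r ?exprn_ge0 ?norm2_ge0//.
  apply: le_trans (gL _ _ _ _ _ _) _ => //.
  - exact: convex_set_line.
  - by rewrite /s' norm2Z ger0_norm ?invr_ge0 ?norm2_ge0// mulVf// gt_eqF.
  by rewrite ler_wpM2l// addrC addKr norm2Z ger0_norm// ler_piMl// norm2_ge0.
have := taylor_remainder dphi phiM (t := 1); rewrite horner_taylor// scale1r.
by rewrite /phi scale1r; apply; rewrite ler01 lexx.
Qed.

Lemma taylor_line g p x s : diffn p g -> exists2 C : R, 0 <= C & forall d,
  exists P : {poly R}, [/\ (size P <= p.+1)%N,
    forall t, taylor g p x (s + t *: d) = P.[t] &
    forall i, `|P`_i| <= C * norm2 d ^+ i].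
Proof.
move=> dg; pose A := 1 + norm2 s.
have A1 : 1 <= A by rewrite lerDl norm2_ge0.
have sA : norm2 s <= A by rewrite lerDr.
have [M M0 hM] := @nabla_poly R n g p x s A dg A1 sA.
have Cl0 (l : nat) : 0 <= (l`!%:R)^-1 * ((2 * A) ^+ l * M).
  rewrite mulr_ge0 ?invr_ge0// mulr_ge0// exprn_ge0// mulr_ge0//.
  exact: le_trans A1.
exists (\sum_(l < p.+1) (l`!%:R)^-1 * ((2 * A) ^+ l * M)); first exact: sumr_ge0.
move=> d; have /choice[P hP] : forall l, exists P : {poly R}, (l <= p)%N ->
    [/\ (size P <= l.+1)%N,
    forall t, nabla g (nseq l (s + t *: d)) x = P.[t] &
    forall i, `|P`_i| <= (2 * A) ^+ l * M * norm2 d ^+ i].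
  move=> l; have [lp|_] := leqP l p; last by exists 0.
  have [|P [sP PE PM]] := hM d l [::]; first by rewrite addn0.
  exists P => _; split => [//|t|i]; first by rewrite -PE cats0.
  by have := PM i; rewrite big_nil mulr1.
exists (\sum_(l < p.+1) (l`!%:R)^-1 *: P l); split.
- apply: (leq_trans (size_sum _ _ _)); apply/bigmax_leqP => l _.
  have [sP _ _] := hP l (ltn_ord l : (l <= p)%N).
  by rewrite (leq_trans (size_scale_leq _ _))// (leq_trans sP).
- move=> t; rewrite horner_sum; apply: eq_bigr => l _; rewrite hornerZ.
  by have [_ <- _] := hP l (ltn_ord l : (l <= p)%N).
- move=> i; rewrite coef_sum mulr_suml (le_trans (ler_norm_sum _ _ _))//.
  apply: ler_sum => l _; rewrite coefZ normrM ger0_norm ?invr_ge0// -mulrA.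
  rewrite ler_wpM2l ?invr_ge0//.
  by have [_ _ ->] := hP l (ltn_ord l : (l <= p)%N).
Qed.

(** The model of order p and its expansion of order j around s agree up to order
    j in d: the terms of degree above j of a polynomial are left over. *)
Lemma taylor_taylor_error g p x s j : diffn p g -> (j <= p)%N ->
  exists2 C : R, 0 <= C & forall d, norm2 d <= 1 ->
    `|taylor g p x (s + d) - taylor (taylor g p x) j s d| <= C * norm2 d ^+ j.+1.
Proof.
move=> dg jp; have [C C0 hC] := taylor_line x s dg.
exists (p.+1%:R * C) => [|d d1]; first by rewrite mulr_ge0.
have [P [sP PE PM]] := hC d.
have := PE 1; rewrite scale1r => ->; rewrite (taylor_horner _ PE).
rewrite (horner_coef_wide _ sP); under eq_bigr do rewrite expr1n mulr1.
rewrite -(big_mkord xpredT (fun l => P`_l)) -[X in _ - X](big_mkord xpredT (fun l => P`_l)).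
rewrite (@big_cat_nat _ _ _ j.+1)//= addrAC subrr add0r.
rewrite (le_trans (ler_norm_sum _ _ _))//.
apply: (@le_trans _ _ (\sum_(j.+1 <= i < p.+1) C * norm2 d ^+ j.+1)).
  rewrite big_nat [leRHS]big_nat; apply: ler_sum => i /andP[ji ip].
  apply: (le_trans (PM i)); rewrite ler_wpM2l// ler_wiXn2l//.
  exact: norm2_ge0.
rewrite sumr_const_nat -[leLHS]mulr_natl -[leRHS]mulrA ler_wpM2r//.
  by rewrite mulr_ge0// exprn_ge0// norm2_ge0.
by rewrite ler_nat subSS leq_subLR (leq_trans (leqnSn p))// leq_addl.
Qed.

(** A function and its model at x have the same expansion at x. *)
Lemma taylor_taylor0 g p x j d : diffn p g -> (j <= p)%N ->
  taylor (taylor g p x) j 0 d = taylor g j x d.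
Proof.
move=> dg jp; rewrite (@taylor_horner R n _ 0 d (taylor_poly (fun u => g (x + u *: d)) p)).
  apply: eq_bigr => l _; rewrite coef_poly (leq_trans (ltn_ord l))//.
  by rewrite -nabla_line scale0r addr0 mulrC.
by move=> t; rewrite horner_taylor// add0r.
Qed.

(** Both the expansion of g around x + s and that of the model around s are, in
    direction d, polynomials of degree at most p, and on a segment of length at
    most |s| both are within O(|s|^(p+1)) of g. So their coefficients agree, with
    the accuracy given by the length of that segment. *)
Lemma taylor_model_error g p U (G : R) : diffn p g -> convex_set U -> 0 <= G ->
  (forall x s, U x -> U (x + s) ->
    `|g (x + s) - taylor g p x s| <= G * norm2 s ^+ p.+1) ->
  exists2 B : R, 0 <= B & forall x s d j, U x -> U (x + s) -> U (x + s + d) ->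
    s != 0 -> (j <= p)%N ->
    `|taylor g j (x + s) d - taylor (taylor g p x) j s d| <=
      B * (norm2 s ^+ p.+1 + norm2 s ^+ (p.+1 - j) * norm2 d ^+ j).
Proof.
move=> dg cU G0 hG; have [C C0 hC] := @coef_le_sup0r R p.
pose M0 := G * (1 + 2 ^+ p.+1).
have M00 : 0 <= M0 by rewrite mulr_ge0// addr_ge0// exprn_ge0.
exists (p.+1%:R * (C * M0)); first by rewrite !mulr_ge0.
move=> x s d j Ux Uxs Uxsd s0 jp.
have ns0 : 0 < norm2 s by rewrite norm2_gt0.
have nd0 := norm2_ge0 d.
have [C' _ hP] := taylor_line x s dg; have [P [sP PE _]] := hP d.
pose Q := taylor_poly (fun u => g (x + s + u *: d)) p.
have QE t : Q.[t] = taylor g p (x + s) (t *: d) by exact: horner_taylor.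
have sQP : (size (Q - P)%R <= p.+1)%N.
  by rewrite (leq_trans (size_polyD _ _))// geq_max size_poly size_polyN.
have QPM (r t : R) : 0 <= r <= 1 -> r * norm2 d <= norm2 s -> 0 <= t <= r ->
    `|(Q - P).[t]| <= M0 * norm2 s ^+ p.+1.
  move=> /andP[r0 r1] rd /andP[t0 tr].
  have td : norm2 (t *: d) <= norm2 s.
    by rewrite norm2Z ger0_norm// (le_trans _ rd)// ler_wpM2r.
  have Ut : U (x + s + t *: d).
    by apply: convex_set_line => //; rewrite t0 (le_trans tr).
  rewrite hornerD hornerN QE -PE -(subrKA (g (x + s + t *: d))).
  rewrite (le_trans (ler_normD _ _))// /M0 mulrDr mulr1 mulrDl lerD//.
    rewrite distrC (le_trans (hG _ _ Uxs Ut))// ler_wpM2l//.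
    by rewrite ler_pXn2r ?nnegrE ?norm2_ge0.
  rewrite -addrA; rewrite -addrA in Ut; rewrite (le_trans (hG _ _ Ux Ut))//.
  rewrite -mulrA -exprMn ler_wpM2l// ler_pXn2r ?nnegrE ?mulr_ge0 ?norm2_ge0//.
  by rewrite (le_trans (ler_norm2D _ _))//; lra.
have QPj : taylor g j (x + s) d - taylor (taylor g p x) j s d =
    \sum_(l < j.+1) (Q - P)`_l.
  rewrite (taylor_horner _ PE) -[taylor g j _ _](@taylor_taylor0 g p)//.
  rewrite (@taylor_horner R n _ 0 d Q); last by move=> t; rewrite QE add0r.
  by rewrite -sumrB; apply: eq_bigr => l _; rewrite coefB.
pose E := norm2 s ^+ p.+1 + norm2 s ^+ (p.+1 - j) * norm2 d ^+ j.
have E0 : 0 <= E by rewrite addr_ge0 ?mulr_ge0 ?exprn_ge0 ?norm2_ge0.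
suff co l : (l <= j)%N -> `|(Q - P)`_l| <= C * M0 * E.
  rewrite QPj (le_trans (ler_norm_sum _ _ _))//.
  apply: (@le_trans _ _ (\sum_(l < j.+1) C * M0 * E)).
    by apply: ler_sum => l _; apply: co; rewrite -ltnS.
  rewrite sumr_const card_ord -[leLHS]mulr_natl -/E -[leRHS]mulrA ler_wpM2r ?ler_nat//.
  by rewrite !mulr_ge0.
move=> lj; have [ds|sd] := leP (norm2 d) (norm2 s).
  have := hC (Q - P) _ 1 ler01 sQP (fun t => QPM 1 t _ _) l.
  rewrite expr1n mulr1 mul1r ler01 lexx => /(_ isT ds)/le_trans; apply.
  rewrite mulrA ler_wpM2l ?mulr_ge0// lerDl.
  by rewrite ?mulr_ge0 ?exprn_ge0 ?norm2_ge0.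
have d0 : 0 < norm2 d by exact: lt_trans sd.
pose r := norm2 s / norm2 d.
have r0 : 0 < r by rewrite divr_gt0.
have r1 : r <= 1 by rewrite ler_pdivrMr// mul1r ltW.
have := hC (Q - P) (M0 * norm2 s ^+ p.+1) r (ltW r0) sQP _ l.
rewrite -ler_pdivlMr ?exprn_gt0// => /(_ _)/le_trans; apply.
  by move=> t; apply: QPM; [rewrite r1 ltW|rewrite /r divfK// gt_eqF].
rewrite -exprVn /r invf_div mulrA -[leLHS]mulrA ler_wpM2l ?mulr_ge0//.
apply: (@le_trans _ _ (norm2 s ^+ p.+1 * (norm2 d / norm2 s) ^+ j)).
  rewrite ler_wpM2l ?exprn_ge0 ?norm2_ge0// ler_weXn2l//.
  by rewrite ler_pdivlMr// mul1r ltW.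
rewrite expr_div_n mulrA mulrAC -expfB_cond ?gt_eqF// ?lerDr ?exprn_ge0 ?norm2_ge0//.
by rewrite leqW.
Qed.

End TaylorError.

(** * Derivatives of powers of the Euclidean norm *)

Section NormPower.
Context {R : realType} {n : nat}.
Implicit Types (x s d v : 'rV[R]_n).

Lemma le_exp_extremes (k j l : nat) (a b : R) : (l <= j <= k)%N ->
  0 <= a -> 0 <= b -> a ^+ (k - l) * b ^+ l <= a ^+ k + a ^+ (k - j) * b ^+ j.
Proof.
move=> /andP[lj jk] a0 b0; have lk := leq_trans lj jk.
have [ba|ab] := leP b a.
  apply: (@le_trans _ _ (a ^+ (k - l) * a ^+ l)).
    by rewrite ler_wpM2l ?exprn_ge0// lerXn2r ?nnegrE.
  by rewrite -exprD subnK// lerDl mulr_ge0 ?exprn_ge0.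
apply: (@le_trans _ _ (a ^+ (k - j) * b ^+ j)); last by rewrite lerDr exprn_ge0.
have -> : (k - l = (k - j) + (j - l))%N by rewrite addnBA// subnK.
rewrite exprD -mulrA ler_wpM2l ?exprn_ge0//.
rewrite -[in leRHS](subnK lj) exprD ler_wpM2r ?exprn_ge0//.
by apply: lerXn2r; rewrite ?nnegrE// ?ltW.
Qed.

(** In the variable r = <x, d> / (|x| |d|), the derivative of order l of |x|^k in
    direction d is |d|^l |x|^(k - l) times a polynomial in r which depends on k
    and l only. *)
Fixpoint normpow_poly (k l : nat) : {poly R} :=
  if l is l'.+1 then
    (k - l')%:R *: ('X * normpow_poly k l') +
    (1 - 'X ^+ 2) * (normpow_poly k l')^`()
  else 1.

Section Line.
Variables (s d : 'rV[R]_n).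
Hypothesis d0 : d != 0.

Let N (u : R) := norm2 (s + u *: d).
(* The polynomials e and q are <s + u d, d> and |s + u d|^2. *)
Let e : {poly R} := (norm2 d ^+ 2)%:P * 'X + (dot s d)%:P.
Let q : {poly R} := (norm2 d ^+ 2)%:P * 'X ^+ 2 + (2 * dot s d)%:P * 'X +
  (norm2 s ^+ 2)%:P.
Let r (u : R) := e.[u] / (N u * norm2 d).

Let nd0 : norm2 d != 0. Proof. by rewrite norm2_eq0. Qed.

Let qE u : q.[u] = N u ^+ 2.
Proof.
have -> : N u ^+ 2 = norm2 s ^+ 2 + 2 * u * dot s d + u ^+ 2 * norm2 d ^+ 2.
  rewrite /N !sqr_norm2 /dot !mulr_sumr -!big_split/=.
  by apply: eq_bigr => i _; rewrite !mxE; ring.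
by rewrite /q !hornerD !hornerM !hornerC !hornerX; ring.
Qed.

Let eE u : e.[u] = dot (s + u *: d) d.
Proof.
rewrite /e !hornerE sqr_norm2 /dot mulr_suml -big_split/=.
by apply: eq_bigr => i _; rewrite !mxE; ring.
Qed.

Let q_gt0 u : N u != 0 -> 0 < q.[u].
Proof. by move=> Nu; rewrite qE exprn_even_gt0. Qed.

Let near_N0 t : N t != 0 -> \forall u \near t, N u != 0.
Proof.
move=> /q_gt0 qt; near=> u.
have : 0 < q.[u] by near: u; exact: (cvgr_gt _ (@continuous_horner R q t)).
by rewrite qE; apply: contraTneq => ->; rewrite expr0n ltxx.
Unshelve. all: by end_near. Qed.

Let dN t : N t != 0 -> is_derive t 1 N (norm2 d * r t).
Proof.
move=> Nt; have NE : N = Num.sqrt \o horner q.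
  by apply/funext => u /=; rewrite qE sqrtr_sqr ger0_norm ?norm2_ge0.
have Nt' : Num.sqrt q.[t] = N t by rewrite NE.
have := @is_derive1_comp R Num.sqrt (horner q) t _ _
  (is_derive1_sqrt (q_gt0 Nt)) (is_derive_poly q t).
have qd : q^`().[t] = 2 * e.[t] by rewrite /q /e !poly.derivE !hornerE; ring.
rewrite -NE => dNt; apply: (is_derive_eq dNt); rewrite Nt' qd /r.
by field; rewrite Nt nd0.
Qed.

Let dr t : N t != 0 -> is_derive t 1 r (norm2 d * (1 - r t ^+ 2) / N t).
Proof.
move=> Nt; have Ntd : N t * norm2 d != 0 by rewrite mulf_neq0.
have dNd : is_derive t 1 (fun u => N u * norm2 d) (norm2 d * r t * norm2 d).
  have := @is_deriveM _ _ N (cst (norm2 d)) t 1 _ _ (dN Nt) (is_derive_cst _ _ _).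
  by move=> h; apply: (is_derive_eq h); rewrite scaler0 add0r; exact: mulrC.
have ed : e^`().[t] = norm2 d ^+ 2 by rewrite /e !poly.derivE !hornerE.
have := is_deriveM (is_derive_poly e t)
  (@is_deriveV _ (fun u => N u * norm2 d) t _ 1 Ntd dNd).
move=> h; apply: (is_derive_eq h); rewrite ed.
rewrite -[LHS]/(e.[t] * (- (N t * norm2 d) ^- 2 * (norm2 d * r t * norm2 d)) +
  (N t * norm2 d)^-1 * norm2 d ^+ 2).
by rewrite /r; field; rewrite Nt nd0.
Qed.

Let dterm k l t : N t != 0 -> (l < k)%N ->
  is_derive t 1 (fun u => norm2 d ^+ l * N u ^+ (k - l) * (normpow_poly k l).[r u])
   (norm2 d ^+ l.+1 * N t ^+ (k - l.+1) * (normpow_poly k l.+1).[r t]).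
Proof.
move=> Nt lk.
have dP := @is_derive1_comp R (horner (normpow_poly k l)) r t _ _
  (is_derive_poly _ _) (dr Nt).
have dK := is_deriveX (k - l) (dN Nt).
have h := is_deriveM (is_deriveM (is_derive_cst (norm2 d ^+ l) t 1) dK) dP.
rewrite (_ : (fun u => _) =
    cst (norm2 d ^+ l) * N ^+ (k - l) * (horner (normpow_poly k l) \o r)); last first.
  by apply/funext => u; rewrite -[RHS]/(_ * (N ^+ _) u * _) exprfctE.
apply: (is_derive_eq h); rewrite scaler0 addr0.
rewrite -[LHS]/(norm2 d ^+ l * (N ^+ (k - l)) t * (_ * _) +
  (normpow_poly k l).[r t] * (norm2 d ^+ l * (_ * _))) exprfctE.
rewrite -subnS -(subnSK lk) /= hornerD hornerZ !hornerM hornerX !hornerD hornerC.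
rewrite hornerN hornerXn -(subnSK lk) !exprS.
by field; rewrite Nt.
Qed.

Lemma derive_normpow k l t : s + t *: d != 0 -> (l <= k)%N ->
  ((fun u : R => norm2 (s + u *: d) ^+ k)^`(l) t)%classic =
  norm2 d ^+ l * N t ^+ (k - l) * (normpow_poly k l).[r t].
Proof.
rewrite -norm2_eq0; elim: l t => [|l IH] t Nt lk.
  by rewrite expr0 mul1r subn0 hornerC mulr1.
rewrite derive1nS derive1E.
rewrite (@near_eq_derive _ _ _ _ (fun u => norm2 d ^+ l * N u ^+ (k - l) * (normpow_poly k l).[r u])).
  by have dt := dterm Nt lk; rewrite derive_val.
near=> u; apply: IH; last exact: ltnW.
by near: u; exact: near_N0.
Unshelve. all: by end_near. Qed.

Lemma derivable_normpow k l t : s + t *: d != 0 -> (l < k)%N ->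
  derivable ((fun u : R => norm2 (s + u *: d) ^+ k)^`(l))%classic t 1.
Proof.
rewrite -norm2_eq0 => Nt lk; have [dt _] := dterm Nt lk.
apply: (near_eq_derivable _ dt); near=> u.
apply/esym/derive_normpow; last exact: ltnW.
by rewrite -norm2_eq0; near: u; exact: near_N0.
Unshelve. all: by end_near. Qed.

Lemma normpow_cos_le1 t : s + t *: d != 0 -> `|r t| <= 1.
Proof.
move=> st; rewrite /r eE normrM normfV.
have p0 : 0 < N t * norm2 d by rewrite mulr_gt0 ?norm2_gt0.
by rewrite (ger0_norm (ltW p0)) ler_pdivrMr// mul1r cauchy_schwarz.
Qed.

End Line.

(** By homogeneity; the constant is uniform because the polynomials depend on k and
    l only, and the cosine r is at most one in absolute value. *)
Lemma normpow_derive_le k : exists2 K : R, 0 <= K & forall s d t l,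
  s + t *: d != 0 -> (l <= k)%N ->
  `|((fun u : R => norm2 (s + u *: d) ^+ k)^`(l) t)%classic| <=
    K * (norm2 (s + t *: d) ^+ (k - l) * norm2 d ^+ l).
Proof.
pose S l := \sum_(i < size (normpow_poly k l)) `|(normpow_poly k l)`_i|.
have S0 l : 0 <= S l by apply: sumr_ge0.
pose K := 1 + \sum_(l < k.+1) S l.
have K0 : 0 <= \sum_(l < k.+1) S l by apply: sumr_ge0.
exists K => [|s d t l st lk]; first by rewrite addr_ge0.
have [->|d0] := eqVneq d 0.
  rewrite -(nabla_line (fun x => norm2 x ^+ k)) scaler0 addr0 norm20; case: l lk => [_|l _].
    by rewrite subn0 expr0 mulr1 ger0_norm ?exprn_ge0 ?norm2_ge0// ler_peMl ?exprn_ge0 ?norm2_ge0// lerDl.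
  by rewrite -[nabla _ _ _]/('D_0 _ _) derive0 normr0 expr0n/= !mulr0.
rewrite derive_normpow// normrM ger0_norm ?mulr_ge0 ?exprn_ge0 ?norm2_ge0//.
rewrite mulrC [X in _ * X]mulrC ler_wpM2r ?mulr_ge0 ?exprn_ge0 ?norm2_ge0//.
apply: (@le_trans _ _ (S l)).
  rewrite horner_coef (le_trans (ler_norm_sum _ _ _))//; apply: ler_sum => i _.
  by rewrite normrM ler_piMr// normrX exprn_ile1// normpow_cos_le1.
rewrite -ltnS in lk; rewrite /K (bigD1 (Ordinal lk))//= addrCA lerDl.
by rewrite addr_ge0// sumr_ge0.
Qed.

Lemma horner_taylor1 (g : 'rV[R]_n -> R) j x s :
  (taylor_poly (fun u => g (x + u *: s)) j).[1] = taylor g j x s.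
Proof.
rewrite horner_taylor_poly; apply: eq_bigr => l _.
by rewrite expr1n mulr1 mulrC.
Qed.

Lemma normpow_taylor_le k : exists2 K : R, 0 <= K & forall s d j,
  s != 0 -> (j <= k)%N ->
  `|taylor (fun x => norm2 x ^+ k) j s d - norm2 s ^+ k| <=
    K * (norm2 s ^+ k + norm2 s ^+ (k - j) * norm2 d ^+ j).
Proof.
have [K K0 hK] := normpow_derive_le k.
exists (k%:R * K) => [|s d j s0 jk]; first by rewrite mulr_ge0.
have -> : taylor (fun x => norm2 x ^+ k) j s d - norm2 s ^+ k =
    \sum_(l < j) nabla (fun x => norm2 x ^+ k) (nseq l.+1 d) s / l.+1`!%:R.
  rewrite /taylor big_ord_recl/= fact0 invr1 scale1r addrAC subrr add0r.
  by apply: eq_bigr => l _; rewrite mulrC.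
set E := _ + _; rewrite (le_trans (ler_norm_sum _ _ _))//.
have E0 : 0 <= E by rewrite addr_ge0 ?mulr_ge0 ?exprn_ge0 ?norm2_ge0.
apply: (@le_trans _ _ (\sum_(l < j) K * E)); last first.
  rewrite sumr_const card_ord -[leLHS]mulr_natl -[leRHS]mulrA ler_wpM2r ?mulr_ge0//.
  by rewrite ler_nat.
apply: ler_sum => l _.
have lk : (l.+1 <= k)%N by rewrite (leq_trans (ltn_ord l)).
have := hK s d 0 l.+1; rewrite -(nabla_line (fun x => norm2 x ^+ k)) scale0r addr0 => /(_ s0 lk) h.
rewrite normrM (@ger0_norm _ (_^-1)) ?invr_ge0//.
apply: (le_trans (ler_piMr _ _)) => //.
  by rewrite invf_le1 ?ler1n ?ltr0n fact_gt0.
by apply: (le_trans h); rewrite ler_wpM2l// le_exp_extremes ?norm2_ge0// ltn_ord.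
Qed.

Lemma taylor_dir0 (W : normedModType R) (g : 'rV[R]_n -> W) j x :
  taylor g j x 0 = g x.
Proof.
rewrite /taylor big_ord_recl/= fact0 invr1 scale1r big1 ?addr0// => l _.
by rewrite derive0 scaler0.
Qed.

Lemma normpow_taylor_error k s j : s != 0 -> (j < k)%N ->
  exists2 C : R, 0 <= C & forall d, norm2 d <= norm2 s / 2 ->
  `|norm2 (s + d) ^+ k - taylor (fun x => norm2 x ^+ k) j s d| <=
    C * norm2 d ^+ j.+1.
Proof.
move=> s0 jk; have [K K0 hK] := normpow_derive_le k.
have ns0 : 0 < norm2 s by rewrite norm2_gt0.
pose C := K * (2 * norm2 s) ^+ (k - j.+1).
have C0 : 0 <= C by rewrite mulr_ge0// exprn_ge0// mulr_ge0// ltW.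
exists (3 * C) => [|d ds]; first by rewrite mulr_ge0.
have [->|d0] := eqVneq d 0.
  by rewrite taylor_dir0 addr0 subrr normr0 norm20 expr0n mulr0.
have nd := norm2_ge0 d.
have td (t : R) : 0 <= t <= 1 -> norm2 (t *: d) <= norm2 d.
  by move=> /andP[t0 t1]; rewrite norm2Z ger0_norm// ler_piMl.
have st (t : R) : 0 <= t <= 1 -> s + t *: d != 0.
  move=> /td t01; rewrite addr_eq0; apply/eqP => sd; move: t01.
  by rewrite -norm2N -sd; lra.
pose phi (u : R) := norm2 (s + u *: d) ^+ k.
have phiM (t : R) : 0 <= t <= 1 -> `|(phi^`(j.+1) t)%classic| <= C * norm2 d ^+ j.+1.
  move=> t01; apply: (le_trans (hK s d t j.+1 (st t t01) jk)).
  rewrite -mulrA ler_wpM2l// ler_wpM2r ?exprn_ge0//.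
  apply: lerXn2r; rewrite ?nnegrE ?norm2_ge0 ?mulr_ge0 ?norm2_ge0//.
  rewrite (le_trans (ler_norm2D _ _))//; have := td t t01; lra.
have dphi l (t : R) : (l < j.+1)%N -> 0 <= t <= 1 -> derivable (phi^`(l))%classic t 1.
  by move=> lj t01; apply: derivable_normpow => //; [exact: st|exact: leq_trans jk].
have i0 : 0 <= (0 : R) <= 1 by rewrite lexx ler01.
have i1 : 0 <= (1 : R) <= 1 by rewrite lexx ler01.
have osc (t : R) : 0 <= t <= 1 ->
    `|(phi^`(j.+1) t)%classic - (phi^`(j.+1) 0)%classic| <= 2 * (C * norm2 d ^+ j.+1).
  move=> t01; rewrite (le_trans (ler_normB _ _))//.
  have := phiM t t01; have := phiM 0 i0; lra.
have := taylor_remainder dphi osc i1.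
rewrite /phi scale1r (horner_taylor1 (fun x => norm2 x ^+ k)) => rem.
have := phiM 0 i0; rewrite -(nabla_line (fun x => norm2 x ^+ k)) scale0r addr0.
move: rem; rewrite {1}/taylor big_ord_recr/= -/(taylor _ j s d) => rem top.
have {}top : `|(j.+1`!%:R)^-1 *: nabla (fun x => norm2 x ^+ k) (nseq j.+1 d) s| <= C * norm2 d ^+ j.+1.
  rewrite normrM (@ger0_norm _ (_^-1)) ?invr_ge0// (le_trans _ top)// ler_piMl//.
  by rewrite invf_le1 ?ler1n ?ltr0n fact_gt0.
set a := norm2 (s + d) ^+ k in rem *; set b := taylor _ j s d in rem *.
set c := _ *: _ in top rem.
have -> : a - b = (a - (b + c)) + c by ring.
rewrite (le_trans (ler_normD _ _))//; rewrite -mulrA; lra.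
Qed.

End NormPower.

(** * Vector-valued functions by coordinates *)

Section Coordinates.
Context {R : realType} {n m : nat}.
Implicit Types (x s d : 'rV[R]_n) (c : 'rV[R]_n -> 'rV[R]_m).

Lemma nabla_coord c vs i : diffn (size vs) c ->
  nabla (fun y => c y 0 i) vs = fun x => nabla c vs x 0 i.
Proof.
elim: vs => [//|v vs IH] dc; apply/funext => x.
rewrite -[LHS]/('D_v (nabla _ vs) x) IH; last exact: diffnW dc.
rewrite -[nabla c (v :: vs) x]/('D_v (nabla c vs) x) derive_mx ?mxE//.
exact/diff_derivable/dc.
Qed.

Lemma diffn_coord c k i : diffn k c -> diffn k (fun y => c y 0 i).
Proof.
move=> dc vs sv x; rewrite nabla_coord; last exact: diffnW (ltnW sv) dc.
apply: (@differentiable_comp _ _ _ _ (nabla c vs) (fun M : 'rV_m => M 0 i)).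
  exact: dc.
exact: differentiable_coord.
Qed.

Lemma taylor_coord c j x s i : diffn j c ->
  (taylor c j x s) 0 i = taylor (fun y => c y 0 i) j x s.
Proof.
move=> dc; rewrite summxE; apply: eq_bigr => l _.
rewrite nabla_coord ?mxE//; apply: diffnW dc.
by rewrite size_nseq -ltnS.
Qed.

(** The coordinates of a derivative are the derivatives of the coordinates only
    where the function is derivable; polynomial coordinates ensure this at every
    order. *)
Lemma derive1n_coord (phi : R -> 'rV[R]_m) l i t :
  (forall i, exists P : {poly R}, forall u, phi u 0 i = P.[u]) ->
  ((phi^`(l) t)%classic) 0 i = ((fun u => phi u 0 i)^`(l) t)%classic.
Proof.
move=> phiP; elim: l i t => [//|l IH] i t.
have dphi : derivable (phi^`(l))%classic t 1.
  apply/derivable_mxP => k i'; rewrite ord1; have [P PE] := phiP i'.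
  rewrite (_ : (fun u => _) = horner (P^`(l))); first exact: derivable_horner.
  rewrite -horner_derive1n; apply/funext => u; rewrite IH.
  by congr (derive1n _ _ _); exact/funext.
rewrite !derive1nS !derive1E derive_mx// mxE; congr ('D_1 _ t).
by apply/funext => u; rewrite IH.
Qed.

Lemma taylor_taylor_coord c p j x s d i : diffn p c ->
  (taylor (taylor c p x) j s d) 0 i =
  taylor (taylor (fun y => c y 0 i) p x) j s d.
Proof.
move=> dc; rewrite summxE; apply: eq_bigr => l _; rewrite mxE; congr (_ * _).
have := nabla_line (taylor c p x) l s d 0; rewrite scale0r addr0 => ->.
rewrite derive1n_coord => [|i'].
  have := nabla_line (taylor (fun y => c y 0 i) p x) l s d 0.
  rewrite scale0r addr0 => ->; congr (derive1n _ _ _).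
  by apply/funext => u; rewrite taylor_coord.
have [C _ /(_ d)[P [_ PE _]]] := taylor_line x s (diffn_coord i' dc).
by exists P => u; rewrite -PE taylor_coord.
Qed.

End Coordinates.

(** * The composite objective and its models *)

Section Auxiliary.
Context {R : realType}.

(** The type T collects all the parameters in which the bound is uniform. *)
Lemma norm2_le_of_coords (m : nat) (T : Type) (D : T -> Prop)
    (u : T -> 'rV[R]_m) (e : T -> R) : (forall t, D t -> 0 <= e t) ->
  (forall i, exists2 C : R, 0 <= C & forall t, D t -> `|u t 0 i| <= C * e t) ->
  exists2 C : R, 0 <= C & forall t, D t -> norm2 (u t) <= C * e t.
Proof.
move=> e0 uC; have /choice[C hC] : forall i, exists C : R,
    0 <= C /\ forall t, D t -> `|u t 0 i| <= C * e t.
  by move=> i; have [C C0 hC] := uC i; exists C.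
have S0 : 0 <= \sum_i C i by apply: sumr_ge0 => i _; case: (hC i).
exists (m%:R * \sum_i C i) => [|t Dt]; first by rewrite mulr_ge0.
rewrite -mulrA; apply: norm2_le_coord => [|i]; first by rewrite mulr_ge0// e0.
have [_ /(_ t Dt)/le_trans] := hC i; apply; rewrite ler_wpM2r ?e0//.
by rewrite (bigD1 i)//= lerDl sumr_ge0// => k _; case: (hC k).
Qed.

Lemma attained_inf (A : set R) : attained A -> A (inf A) /\ lbound A (inf A).
Proof.
move=> [a Aa lba]; suff -> : inf A = a by [].
apply/eqP; rewrite eq_le; apply/andP; split; last first.
  by apply: lb_le_inf => //; exists a.
by apply: (@ge_inf R A _ a Aa); exists a.
Qed.

Lemma small_radius (C kappa r : R) j : 0 <= C -> 0 < kappa -> 0 < r ->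
  exists2 delta : R, 0 < delta <= 1 & delta <= r /\
    C * delta ^+ j.+1 <= kappa * delta ^+ j.
Proof.
move=> C0 k0 r0; pose b := kappa / (C + 1).
have b0 : 0 < b by rewrite divr_gt0// ltr_wpDl.
exists (Num.min 1 (Num.min r b)).
  by rewrite !lt_min ltr01 r0 b0/= ge_min lexx.
split; first by rewrite !ge_min lexx orbT.
have d0 : 0 < Num.min 1 (Num.min r b) by rewrite !lt_min ltr01 r0 b0.
rewrite exprS mulrA ler_wpM2r ?exprn_ge0 ?(ltW d0)//.
apply: (@le_trans _ _ (C * b)).
  by rewrite ler_wpM2l// !ge_min lexx !orbT.
by rewrite /b mulrCA ler_piMr ?(ltW k0)// ler_pdivrMr ?mul1r ?lerDl// ltr_wpDl.
Qed.

End Auxiliary.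

Section Objective.
Context {R : realType} {n m : nat}.
Variables (p : nat) (F : set 'rV[R]_n).
Variables (f : 'rV[R]_n -> R) (c : 'rV[R]_n -> 'rV[R]_m) (h : 'rV[R]_m -> R).
Variables (Lf Lc : nat -> R) (Lh : R).
Hypotheses (p_gt0 : (0 < p)%N) (as1 : AS1 p F f Lf) (as2 : AS2 p F c Lc)
  (as3 : AS3 h Lh).
Implicit Types (x s d : 'rV[R]_n).

Lemma nabla_lipschitz (W : normedModType R) (nW : W -> R) (g : 'rV[R]_n -> W) L :
  derivative_lipschitz nW F g p L -> exists U : set 'rV[R]_n,
    [/\ convex_set U, F `<=` U & forall x y v, U x -> U y -> norm2 v = 1 ->
    nW (nabla g (nseq p v) x - nabla g (nseq p v) y) <= L * norm2 (x - y)].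
Proof.
move=> [U [_ cU FU UL]]; exists U; split => // x y v Ux Uy v1.
rewrite -lee_fin; apply: le_trans (UL x y Ux Uy).
apply: ereal_sup_ubound; exists (nseq_tuple p v) => //.
by move=> u; rewrite /= mem_nseq => /andP[_ /eqP ->].
Qed.

(** The property shared by f and the coordinates of c from which all the error
    bounds derive. The convex neighbourhood U is kept because the segment between
    two feasible points may leave F. *)
Definition modelled (g : 'rV[R]_n -> R) := diffn p g /\
  exists U (G : R), [/\ convex_set U, F `<=` U, 0 <= G & forall x s, U x -> U (x + s) ->
    `|g (x + s) - taylor g p x s| <= G * norm2 s ^+ p.+1].

Lemma modelled_f : modelled f.
Proof.
have [[df _] Lf1 LipF] := as1.
have [|U [cU FU UL]] := nabla_lipschitz (LipF p _); first by rewrite p_gt0/=.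
split => //; exists U, (Lf p); have L0 : 0 <= Lf p by exact: le_trans (Lf1 p _).
by split => //; apply: taylor_error UL.
Qed.

Lemma diffn_c : diffn p c.
Proof. by case: as2 => -[]. Qed.

Lemma modelled_c i : modelled (fun y => c y 0 i).
Proof.
have [_ Lc1 LipC] := as2; have dc := diffn_c.
have [|U [cU FU UL]] := nabla_lipschitz (LipC p _); first by rewrite p_gt0/=.
split; first exact: diffn_coord.
exists U, (Lc p); have L0 : 0 <= Lc p by exact: le_trans (Lc1 p _).
split => //; apply: taylor_error => // [|x y v Ux Uy v1]; first exact: diffn_coord.
rewrite nabla_coord; last by rewrite size_nseq.
apply: le_trans (UL x y v Ux Uy v1); apply: le_trans (coord_le_norm2 _ i).
by rewrite !mxE.
Qed.

Lemma modelled_error g : modelled g -> exists2 G : R, 0 <= G & forall x s,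
  F x -> F (x + s) -> `|g (x + s) - taylor g p x s| <= G * norm2 s ^+ p.+1.
Proof.
move=> [_ [U [G [_ FU G0 hG]]]]; exists G => // x s Fx Fxs.
by apply: hG; exact: FU.
Qed.

Lemma modelled_model_error g : modelled g ->
  exists2 B : R, 0 <= B & forall x s d j, F x -> F (x + s) -> F (x + s + d) ->
    s != 0 -> (j <= p)%N ->
    `|taylor g j (x + s) d - taylor (taylor g p x) j s d| <=
      B * (norm2 s ^+ p.+1 + norm2 s ^+ (p.+1 - j) * norm2 d ^+ j).
Proof.
move=> [dg [U [G [cU FU G0 hG]]]].
have [B B0 hB] := taylor_model_error dg cU G0 hG.
by exists B => // x s d j /FU Ux /FU Uxs /FU Uxsd; exact: hB.
Qed.

Lemma h_lipschitz (y z : 'rV[R]_m) : `|h y - h z| <= Lh * norm2 (y - z).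
Proof. by case: as3. Qed.

Lemma Lh_ge0 : 0 <= Lh.
Proof. by case: as3. Qed.

(** As in the optimality measures, h is applied to the expansion of its argument
    and is not expanded itself. *)
Definition model_expansion x s j d : R :=
  taylor (taylor f p x) j s d + h (taylor (taylor c p x) j s d).

Lemma composite_le (a b : R) (y z : 'rV[R]_m) (A C : R) :
  `|a - b| <= A -> norm2 (y - z) <= C ->
  `|(a + h y) - (b + h z)| <= A + Lh * C.
Proof.
move=> ab yz; have -> : a + h y - (b + h z) = (a - b) + (h y - h z) by ring.
rewrite (le_trans (ler_normD _ _))// lerD// (le_trans (h_lipschitz _ _))//.
by rewrite ler_wpM2l// Lh_ge0.
Qed.

Lemma objective_error : exists2 G : R, 0 <= G & forall x s, F x -> F (x + s) ->
  `|w f c h (x + s) - taylor_w f c h p x s| <= G * norm2 s ^+ p.+1.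
Proof.
have [Gf Gf0 hf] := modelled_error modelled_f.
have [||Gc Gc0 hc] := @norm2_le_of_coords R m ('rV[R]_n * 'rV[R]_n)%type
    (fun xs => F xs.1 /\ F (xs.1 + xs.2))
    (fun xs => c (xs.1 + xs.2) - taylor c p xs.1 xs.2)
    (fun xs => norm2 xs.2 ^+ p.+1).
- by move=> xs _; rewrite exprn_ge0// norm2_ge0.
- move=> i; have [G G0 hG] := modelled_error (modelled_c i).
  exists G => // -[x s] /= [Fx Fxs]; rewrite !mxE taylor_coord; last exact: diffn_c.
  exact: hG.
exists (Gf + Lh * Gc) => [|x s Fx Fxs].
  by rewrite addr_ge0// mulr_ge0// Lh_ge0.
have := composite_le (hf x s Fx Fxs) (hc (x, s) (conj Fx Fxs)).
by rewrite mulrDl -mulrA.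
Qed.

Lemma expansion_error : exists2 B : R, 0 <= B & forall x s d j,
  F x -> F (x + s) -> F (x + s + d) -> s != 0 -> (j <= p)%N ->
  `|taylor_w f c h j (x + s) d - model_expansion x s j d| <=
    B * (norm2 s ^+ p.+1 + norm2 s ^+ (p.+1 - j) * norm2 d ^+ j).
Proof.
have [Bf Bf0 hf] := modelled_model_error modelled_f.
pose T := (('rV[R]_n * 'rV[R]_n) * ('rV[R]_n * nat))%type.
have [||Bc Bc0 hc] := @norm2_le_of_coords R m T
    (fun t => [/\ F t.1.1, F (t.1.1 + t.1.2), F (t.1.1 + t.1.2 + t.2.1),
       t.1.2 != 0 & (t.2.2 <= p)%N])
    (fun t => taylor c t.2.2 (t.1.1 + t.1.2) t.2.1 -
       taylor (taylor c p t.1.1) t.2.2 t.1.2 t.2.1)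
    (fun t => norm2 t.1.2 ^+ p.+1 +
       norm2 t.1.2 ^+ (p.+1 - t.2.2) * norm2 t.2.1 ^+ t.2.2).
- by move=> t _; rewrite addr_ge0 ?mulr_ge0 ?exprn_ge0 ?norm2_ge0.
- move=> i; have [B B0 hB] := modelled_model_error (modelled_c i).
  exists B => // -[[x s] [d j]] /= [Fx Fxs Fxsd s0 jp]; rewrite !mxE.
  rewrite taylor_coord ?taylor_taylor_coord; [exact: hB|exact: diffn_c|].
  exact: diffnW diffn_c.
exists (Bf + Lh * Bc) => [|x s d j Fx Fxs Fxsd s0 jp].
  by rewrite addr_ge0// mulr_ge0// Lh_ge0.
have := composite_le (hf x s d j Fx Fxs Fxsd s0 jp)
  (hc ((x, s), (d, j)) (And5 Fx Fxs Fxsd s0 jp)).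
by rewrite mulrDl -mulrA.
Qed.

Lemma expansion_remainder x s j : (j <= p)%N -> exists2 C : R, 0 <= C &
  forall d, norm2 d <= 1 ->
  `|taylor_w f c h p x (s + d) - model_expansion x s j d| <= C * norm2 d ^+ j.+1.
Proof.
move=> jp; have [df _] := modelled_f.
have [Cf Cf0 hf] := taylor_taylor_error x s df jp.
have [||Cc Cc0 hc] := @norm2_le_of_coords R m 'rV[R]_n (fun d => norm2 d <= 1)
    (fun d => taylor c p x (s + d) - taylor (taylor c p x) j s d)
    (fun d => norm2 d ^+ j.+1).
- by move=> d _; rewrite exprn_ge0// norm2_ge0.
- move=> i; have dc := diffn_coord i diffn_c.
  have [C C0 hC] := taylor_taylor_error x s dc jp.
  exists C => // d d1; rewrite !mxE taylor_coord ?taylor_taylor_coord;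
    [exact: hC|exact: diffn_c|exact: diffn_c].
exists (Cf + Lh * Cc) => [|d d1]; first by rewrite addr_ge0// mulr_ge0// Lh_ge0.
have := composite_le (hf d d1) (hc d d1).
by rewrite mulrDl -mulrA.
Qed.

Lemma model_expansion0 x j d : (j <= p)%N ->
  model_expansion x 0 j d = taylor_w f c h j x d.
Proof.
move=> jp; rewrite /model_expansion taylor_taylor0//; last by case: modelled_f.
congr (_ + h _); apply/rowP => i.
rewrite taylor_taylor_coord ?taylor_coord ?taylor_taylor0//.
- exact: diffn_coord diffn_c.
- exact: diffnW diffn_c.
- exact: diffn_c.
Qed.

Lemma model0 x sigma : model p f c h x sigma 0 = w f c h x.
Proof.
by rewrite /model /taylor_w !taylor_dir0 norm20 expr0n/= mulr0 addr0.
Qed.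

(** The measure at the new point exceeds that of the model by the errors of the
    model: no cancellation is available between h(c(x + s)) and h of the model of
    c, whence the term |s|^(p+1) without a factor delta. *)
Lemma phi_w_le_phi_model (S : R) : exists2 B : R, 0 <= B &
  forall x s sigma j delta, F x -> F (x + s) -> s != 0 -> (j <= p)%N ->
  0 <= sigma <= S -> 0 < delta ->
  attained (taylor_w_values F f c h j delta (x + s)) ->
  attained (taylor_model_values p F f c h x sigma j delta s) ->
  phi_w F f c h j delta (x + s) <= phi_model p F f c h x sigma j delta s +
    B * (norm2 s ^+ p.+1 + norm2 s ^+ (p.+1 - j) * delta ^+ j).
Proof.
have [G G0 hG] := objective_error; have [B B0 hB] := expansion_error.
have [K K0 hK] := @normpow_taylor_le R n p.+1.
pose S' := Num.max 0 S.
have S0 : 0 <= S' by rewrite le_max lexx.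
exists (G + B + S' * K).
  by rewrite !addr_ge0// mulr_ge0.
move=> x s sigma j delta Fx Fxs s0 jp /andP[sig0 sigS] del0 /attained_inf[].
move=> [d [Fxsd ddel] Td] _ /attained_inf[_ lbm].
have sigS' : sigma <= S' by rewrite le_max sigS orbT.
rewrite /phi_w -Td /phi_model.
have := lbm (taylor_model p f c h x sigma s j d).
move=> /(_ _)-/(_ (ex_intro2 _ _ d (conj Fxsd ddel) erefl)) infle.
have e1 := hG x s Fx Fxs; have e2 := hB x s d j Fx Fxs Fxsd s0 jp.
have e3 := hK s d j s0 (leqW jp).
set P1 := norm2 s ^+ p.+1 in e1 e2 e3 *.
have P0 : 0 <= P1 by rewrite exprn_ge0// norm2_ge0.
set Ed := P1 + norm2 s ^+ (p.+1 - j) * norm2 d ^+ j in e2 e3.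
set E := P1 + norm2 s ^+ (p.+1 - j) * delta ^+ j.
have EdE : Ed <= E.
  rewrite lerD2l ler_wpM2l ?exprn_ge0 ?norm2_ge0//.
  by apply: lerXn2r; rewrite ?nnegrE ?norm2_ge0// ltW.
have Ed0 : 0 <= Ed by rewrite addr_ge0// mulr_ge0// exprn_ge0// norm2_ge0.
have PEd : P1 <= Ed by rewrite lerDl mulr_ge0// exprn_ge0// norm2_ge0.
move: infle; rewrite /taylor_model -/(model_expansion x s j d) /model.
set M := taylor_w f c h p x s; set X := model_expansion x s j d.
set Y := taylor_w f c h j (x + s) d in e2 *.
set Z := taylor _ j s d in e3 *; set k := sigma / _.
have k0 : 0 <= k by rewrite divr_ge0.
have kS : k <= S'.
  rewrite (le_trans _ sigS')// ler_pdivrMr ?ltr0n ?fact_gt0// ler_peMr//.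
  by rewrite ler1n fact_gt0.
have {}e1 := le_trans (ler_norm _) e1.
have {}e2 : X - Y <= B * Ed by rewrite (le_trans (ler_norm _))// distrC.
have {}e3 := le_trans (ler_norm _) e3.
have h1 : k * (Z - P1) <= S' * K * E.
  apply: (@le_trans _ _ (k * (K * Ed))); first by rewrite ler_wpM2l.
  rewrite mulrA ler_pM ?mulr_ge0// ler_wpM2r//.
have h2 : B * Ed <= B * E by rewrite ler_wpM2l.
have h3 : G * P1 <= G * E by rewrite ler_wpM2l// (le_trans PEd).
rewrite -/M in e1; rewrite mulrBr in h1; move=> infle; rewrite -/P1 !mulrDl; lra.
Qed.

Section Stopping.
Variables (q : nat) (a : params R) (eps : nat -> R) (x : 'rV[R]_n) (sigma : R).
Hypotheses (q_le_p : (q <= p)%N) (ha : valid_params a) (eps01 : in_unit q eps)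
  (Fx : F x) (sigma0 : 0 < sigma) (minx : minima_attained p F f c h q x sigma).
Hypothesis no_pair : ~ (exists s deltas,
  admissible_pair p q F f c h a eps x sigma s deltas).

(** A nonzero minimizer of the model would form an admissible pair with small
    enough radii: at such a point the measure of the model of order j is the
    remainder of an expansion of order j, that is O(delta^(j+1)). *)
Lemma model_minimal_at0 s : F (x + s) -> w f c h x <= model p f c h x sigma s.
Proof.
have [minw minm [_ [s' Fs' <-] lbm]] := minx.
have theta0 : 0 < theta a by case: ha => _ /andP[].
move=> Fs; have [s'0|s'0] := eqVneq s' 0.
  by rewrite -(model0 x sigma) -s'0; apply: lbm; exists s.
case: no_pair; exists s'.
have /choice[deltas hd] : forall j, exists delta : R, (1 <= j <= q)%N ->
    0 < delta <= 1 /\ phi_model p F f c h x sigma j delta s' <=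
      theta a * eps j * delta ^+ j / j`!%:R.
  move=> j; have [jq|_] := boolP (1 <= j <= q)%N; last by exists 0.
  have [eps0 _] := andP (eps01 jq); have /andP[j1 jq'] := jq.
  have jp := leq_trans jq' q_le_p.
  have [C1 C10 hC1] := expansion_remainder x s' jp.
  have [C2 C20 hC2] := normpow_taylor_error s'0 (jp : (j < p.+1)%N).
  have r0 : 0 < norm2 s' / 2 by rewrite divr_gt0// norm2_gt0.
  pose k := sigma / p.+1`!%:R.
  have k0 : 0 <= k by rewrite divr_ge0// ltW.
  have kap0 : 0 < theta a * eps j / j`!%:R.
    by rewrite divr_gt0 ?mulr_gt0// ltr0n fact_gt0.
  have [|delta d01 [dr Cd]] := @small_radius R (C1 + k * C2) _ _ j _ kap0 r0.
    by rewrite addr_ge0// mulr_ge0.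
  exists delta => _; split => //; have /andP[del0 del1] := d01.
  rewrite mulrAC (le_trans _ Cd)//.
  have [[d [Fd ddel] Td] _] := attained_inf (minm j delta s' jq del0 Fs').
  rewrite /phi_model -Td.
  have : model p f c h x sigma s' <= model p f c h x sigma (s' + d).
    by apply: lbm; exists (s' + d) => //=; rewrite addrA.
  rewrite {2}/model /taylor_model -/(model_expansion x s' j d) -/k.
  have := le_trans (ler_norm _) (hC1 d (le_trans ddel del1)).
  have := le_trans (ler_norm _) (hC2 d (le_trans ddel dr)).
  have dd : norm2 d ^+ j.+1 <= delta ^+ j.+1.
    by apply: lerXn2r; rewrite ?nnegrE ?norm2_ge0// ltW.
  set N1 := norm2 (s' + d) ^+ p.+1; set N2 := taylor _ j s' d.
  set T1 := taylor_w _ _ _ _ _ _; set T2 := model_expansion _ _ _ _.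
  move=> r2 r1 m12.
  have r2' := ler_wpM2l k0 r2.
  have r3 := ler_wpM2l (addr_ge0 C10 (mulr_ge0 k0 C20)) dd.
  by move: r2' r3; rewrite mulrBr mulrA !mulrDl; lra.
exists deltas; split => //.
- by move=> j /hd[].
- by apply: lbm; exists 0 => //=; rewrite addr0.
- by move=> j /hd[].
Qed.

Lemma phi_w_small j : (1 <= j <= q)%N ->
  exists2 delta : R, 0 < delta <= 1 &
    phi_w F f c h j delta x <= eps j * delta ^+ j / j`!%:R.
Proof.
move=> jq; have [minw _ _] := minx; have [eps0 _] := andP (eps01 jq).
have /andP[_ jq'] := jq; have jp := leq_trans jq' q_le_p.
have [C C0 hC] := expansion_remainder x 0 jp.
pose k := sigma / p.+1`!%:R.
have k0 : 0 <= k by rewrite divr_ge0// ltW.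
have kap0 : 0 < eps j / j`!%:R by rewrite divr_gt0// ltr0n fact_gt0.
have [|delta d01 [_ Cd]] := @small_radius R (C + k) _ _ j _ kap0 ltr01.
  exact: addr_ge0.
exists delta => //; have /andP[del0 del1] := d01.
rewrite mulrAC (le_trans _ Cd)//.
have [[d [Fd ddel] Td] _] := attained_inf (minw j delta jq del0).
rewrite /phi_w -Td; have := model_minimal_at0 Fd.
have d1 := le_trans ddel del1.
have := le_trans (ler_norm _) (hC d d1).
rewrite add0r (model_expansion0 _ _ jp) /model -/k.
have dd : norm2 d ^+ j.+1 <= delta ^+ j.+1.
  by apply: lerXn2r; rewrite ?nnegrE ?norm2_ge0// ltW.
have dpj : norm2 d ^+ p.+1 <= norm2 d ^+ j.+1.
  by rewrite ler_wiXn2l ?norm2_ge0.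
have r2 := ler_wpM2l k0 dpj.
have r3 := ler_wpM2l (addr_ge0 C0 k0) dd.
by move: r3; rewrite !mulrDl; lra.
Qed.

(** In the convex case the first-order model decreases at least linearly towards
    its minimizer, so that the measure with radius one is at most that with
    radius delta, divided by delta. *)
Lemma phi_w_small1 : (1 <= q)%N -> convex_set F -> convex_fun h ->
  phi_w F f c h 1 1 x <= eps 1%N.
Proof.
move=> q1 cF ch; have [|delta d01] := @phi_w_small 1; first by rewrite q1.
have /andP[del0 del1] := d01; rewrite expr1 (_ : 1`! = 1%N)// divr1.
have [minw _ _] := minx; have q11 : (1 <= 1 <= q)%N by rewrite q1.
have [[d [Fd d1] Td] _] := attained_inf (minw 1%N 1 q11 ltr01).
have [_ lb] := attained_inf (minw 1%N delta q11 del0).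
rewrite /phi_w -Td.
have := lb (taylor_w f c h 1 x (delta *: d)).
have Fdd : F (x + delta *: d) /\ norm2 (delta *: d) <= delta.
  split; first by apply: convex_set_line => //; rewrite ltW.
  by rewrite norm2Z gtr0_norm// ler_piMr// ltW.
move=> /(_ (ex_intro2 _ _ (delta *: d) Fdd erefl)) infle phile.
have T1 (W : normedModType R) (g : 'rV[R]_n -> W) : diffn p g ->
    taylor g 1 x (delta *: d) = delta *: taylor g 1 x d + (1 - delta) *: g x.
  move=> dg; have dgx : differentiable g x by exact: (dg [::]).
  rewrite /taylor !big_ord_recl !big_ord0 !addr0 fact0 /= (_ : (bump 0 0)`! = 1%N)// invr1 !scale1r.
  rewrite -[delta *: d]add0r derive_lin// derive0 add0r scalerDr scalerBl scale1r.
  by rewrite [RHS]addrC addrA subrK.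
have : taylor_w f c h 1 x (delta *: d) <=
    delta * taylor_w f c h 1 x d + (1 - delta) * w f c h x.
  rewrite /taylor_w /w T1; last by case: modelled_f.
  rewrite T1; last exact: diffn_c.
  have := ch (Itv01 (ltW del0) del1) (taylor c 1 x d) (c x).
  rewrite !inE => /(_ Logic.I Logic.I); rewrite /conv/= /unstable.onem.
  rewrite -![_ *: (_ : R^o)]/(_ * _).
  set h1 := h _; set h2 := h (taylor c 1 x d); set h3 := h (c x).
  move=> hh; have {}hh : h1 <= delta * h2 + (1 - delta) * h3 by exact: hh.
  have -> : delta *: taylor f 1 x d + (1 - delta) *: f x =
    delta * taylor f 1 x d + (1 - delta) * f x by [].
  lra.
move=> cvx; rewrite -(ler_pM2l del0); move: phile; rewrite /phi_w; nra.
Qed.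

End Stopping.

End Objective.

(** * Lower bounds on the step *)

Lemma powR_le1 (R : realType) (e y : R) : 0 <= e <= 1 -> 0 <= y -> e `^ y <= 1.
Proof.
move=> /andP[e0 e1] y0; apply: (@le_trans _ _ (1 `^ y)); last by rewrite powR1.
by apply: ge0_ler_powR; rewrite ?nnegrE.
Qed.

Section StepBounds.
Context {R : realType}.

(** Either delta <= r, and the term r^(p+1) dominates, while delta is at least of
    the order of eps; or r < delta, delta^j cancels, and eps = O(r^(p+1-j)), where
    (p + 1 - j) (j + 1) >= p + 1. *)
Lemma step_lower_bound (p q : nat) (c0 B kd xi : R) : (q <= p)%N ->
  0 < c0 -> 0 <= B -> 0 < kd -> 0 < xi ->
  exists2 kappa : R, 0 < kappa & forall j (e delta r : R), (1 <= j <= q)%N ->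
    0 < e <= 1 -> 0 < delta <= 1 -> 0 <= r -> (r <= xi -> kd * e <= delta) ->
    c0 * e * delta ^+ j <= B * (r ^+ p.+1 + r ^+ (p.+1 - j) * delta ^+ j) ->
    kappa * e ^+ j.+1 <= r ^+ p.+1.
Proof.
move=> qp c00 B0 kd0 xi0.
pose k := Num.min 1 kd; pose x1 := Num.min 1 xi.
pose u := Num.min 1 (c0 / (2 * (B + 1))).
have B10 : 0 < 2 * (B + 1) by lra.
have k0 : 0 < k by rewrite lt_min ltr01.
have x10 : 0 < x1 by rewrite lt_min ltr01.
have u0 : 0 < u by rewrite lt_min ltr01 divr_gt0.
have k1 : k <= 1 by rewrite ge_min lexx.
have u1 : u <= 1 by rewrite ge_min lexx.
have x11 : x1 <= 1 by rewrite ge_min lexx.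
(* The three terms serve the cases r > min(1, xi), delta <= r and r < delta. *)
pose kappa := Num.min (x1 ^+ p.+1) (Num.min (u * k ^+ q) (u ^+ q.+1)).
exists kappa; first by rewrite !lt_min !exprn_gt0// mulr_gt0// exprn_gt0.
move=> j e delta r /andP[j1 jq] /andP[e0 e1] /andP[d0 d1] r0 rd main.
have e10 : 0 <= e ^+ j.+1 by rewrite exprn_ge0// ltW.
have e11 : e ^+ j.+1 <= 1 by rewrite exprn_ile1// ltW.
have [rx|xr] := leP r x1; last first.
  apply: (@le_trans _ _ (x1 ^+ p.+1)).
    apply: (@le_trans _ _ (x1 ^+ p.+1 * e ^+ j.+1)).
      by rewrite ler_wpM2r// ge_min lexx.
    by rewrite ler_piMr// exprn_ge0// ltW.
  by apply: lerXn2r; rewrite ?nnegrE// ltW.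
have r1 : r <= 1 by exact: le_trans x11.
have {}rd : k * e <= delta.
  have /rd : r <= xi by apply: le_trans rx _; rewrite ge_min lexx orbT.
  by apply: le_trans; rewrite ler_wpM2r ?(ltW e0)// ge_min lexx orbT.
have jp : (j <= p.+1)%N by rewrite leqW// (leq_trans jq).
have uc X : c0 * e * delta ^+ j <= B * (X + X) -> 0 <= X ->
    u * e * delta ^+ j <= X.
  move=> cX X0; have : u * (2 * (B + 1)) <= c0.
    by rewrite -ler_pdivlMr// ge_min lexx orbT.
  have ed0 : 0 <= e * delta ^+ j by rewrite mulr_ge0 ?exprn_ge0// ltW.
  move/(ler_wpM2r ed0) => h2; rewrite -(ler_pM2l B10).
  move: h2 cX; rewrite -!mulrA; set Y := e * _; nra.
have [dr|rd'] := leP delta r.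
  have : u * e * delta ^+ j <= r ^+ p.+1.
    apply: uc; last by rewrite exprn_ge0.
    apply: le_trans main _; rewrite ler_wpM2l// lerD2l.
    rewrite -[in leRHS](subnK jp) exprD ler_wpM2l ?exprn_ge0//.
    by apply: lerXn2r; rewrite ?nnegrE// ltW.
  apply: le_trans; rewrite exprSr.
  apply: (@le_trans _ _ (u * k ^+ q * (e ^+ j * e))).
    by rewrite ler_wpM2r ?mulr_ge0 ?exprn_ge0 ?(ltW e0)// !ge_min lexx orbT.
  rewrite [e ^+ j * e]mulrC mulrACA ler_wpM2l ?mulr_ge0 ?(ltW u0) ?(ltW e0)//.
  apply: (@le_trans _ _ ((k * e) ^+ j)); last first.
    by apply: lerXn2r; rewrite ?nnegrE ?mulr_ge0// ltW.
  by rewrite exprMn ler_wpM2r ?exprn_ge0 ?(ltW e0)// ler_wiXn2l// ltW.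
have : u * e * delta ^+ j <= r ^+ (p.+1 - j) * delta ^+ j.
  apply: uc; last by rewrite mulr_ge0 ?exprn_ge0// ltW.
  apply: le_trans main _; rewrite ler_wpM2l// lerD2r.
  rewrite -[in leLHS](subnK jp) exprD ler_wpM2l ?exprn_ge0//.
  by apply: lerXn2r; rewrite ?nnegrE// ltW.
rewrite ler_pM2r ?exprn_gt0// => ue.
apply: (@le_trans _ _ ((u * e) ^+ j.+1)).
  rewrite exprMn ler_wpM2r//.
  apply: (@le_trans _ _ (u ^+ q.+1)); first by rewrite !ge_min lexx !orbT.
  by rewrite ler_wiXn2l// ltW.
apply: (@le_trans _ _ ((r ^+ (p.+1 - j)) ^+ j.+1)).
  by apply: lerXn2r; rewrite ?nnegrE ?mulr_ge0 ?exprn_ge0// ltW.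
rewrite -exprM ler_wiXn2l//.
have jqp : (j <= p)%N by exact: leq_trans qp.
by rewrite subSn// mulSn -[in leqLHS](subnKC jqp) -addSn leq_add2l leq_pmulr.
Qed.

(** With delta = 1 and j = 1, eps is O(r^p) as soon as r <= 1. *)
Lemma step_lower_bound1 (p : nat) (c0 B : R) : (0 < p)%N -> 0 < c0 -> 0 <= B ->
  exists2 kappa : R, 0 < kappa & forall e r : R, 0 < e <= 1 -> 0 <= r ->
    c0 * e <= B * (r ^+ p.+1 + r ^+ p) ->
    kappa * e `^ (p.+1%:R / p%:R) <= r ^+ p.+1.
Proof.
move=> p0 c00 B0; pose al : R := p.+1%:R / p%:R.
have al0 : 0 <= al by rewrite divr_ge0.
have B10 : 0 < 2 * (B + 1) by lra.
pose u := Num.min 1 (c0 / (2 * (B + 1))).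
have u0 : 0 < u by rewrite lt_min ltr01 divr_gt0.
have u1 : u <= 1 by rewrite ge_min lexx.
exists (u `^ al); first exact: powR_gt0.
move=> e r /andP[e0 e1] r0 main; rewrite -/al -powRM ?(ltW u0) ?(ltW e0)//.
have ue0 : 0 <= u * e by rewrite mulr_ge0// ltW.
have [r1|r1] := leP r 1; last first.
  apply: (@le_trans _ _ 1); last by rewrite exprn_ege1// ltW.
  apply: (@le_trans _ _ (1 `^ al)); last by rewrite powR1.
  apply: ge0_ler_powR => //; rewrite ?nnegrE//.
  by rewrite (le_trans _ u1)// ler_piMr// ltW.
have ue : u * e <= r ^+ p.
  have rr : r ^+ p.+1 <= r ^+ p by rewrite ler_wiXn2l.
  have uB : u * (2 * (B + 1)) <= c0.
    by rewrite -ler_pdivlMr// ge_min lexx orbT.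
  have h2 := ler_wpM2r (ltW e0) uB.
  have h3 := ler_wpM2l B0 rr.
  have rp : 0 <= r ^+ p by rewrite exprn_ge0.
  by rewrite -(ler_pM2l B10); nra.
have -> : r ^+ p.+1 = (r ^+ p) `^ al.
  rewrite -!powR_mulrn// -powRrM; congr (_ `^ _).
  by rewrite /al mulrCA mulfV ?mulr1// pnatr_eq0 -lt0n.
by apply: ge0_ler_powR => //; rewrite nnegrE// exprn_ge0.
Qed.

End StepBounds.

(** * Runs of the algorithm *)

Section Run.
Context {R : realType} {n m : nat}.
Variables (p q : nat) (F : set 'rV[R]_n).
Variables (f : 'rV[R]_n -> R) (c : 'rV[R]_n -> 'rV[R]_m) (h : 'rV[R]_m -> R).
Variables (Lf Lc : nat -> R) (Lh wlow : R) (a : params R) (x0 : 'rV[R]_n).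
Hypotheses (q_gt0 : (0 < q)%N) (q_le_p : (q <= p)%N).
Hypotheses (as1 : AS1 p F f Lf) (as2 : AS2 p F c Lc) (as3 : AS3 h Lh)
  (as4 : AS4 F f c h wlow) (ha : valid_params a) (hx0 : F x0).

Local Notation W := (w f c h).
Local Notation D := (W x0 - wlow).

Let p_gt0 : (0 < p)%N. Proof. exact: leq_trans q_le_p. Qed.

Definition admissible_run (eps : nat -> R) (z : iterates R n) : Prop :=
  [/\ in_unit q eps, is_run p q F f c h a x0 eps z,
      run_minima_attained p q F f c h a eps z &
      radius_rule p q F f c h a eps z Lf Lc Lh].

Section OneRun.
Variables (eps : nat -> R) (z : iterates R n).
Hypothesis run : admissible_run eps z.
Local Notation x := (it_x z).
Local Notation s := (it_s z).
Local Notation sg := (it_sigma z).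
Local Notation rch := (reached p q F f c h a eps z).
Local Notation succ := (successful p f c h a z).

Lemma reachedW k l : (k <= l)%N -> rch l -> rch k.
Proof. by move=> kl rl i ik; apply: rl; exact: leq_trans kl. Qed.

Lemma reached_iteration k : rch k.+1 -> iteration p q F f c h a eps z k.
Proof. by case: run => _ [_ _ _ H] _ _; exact: H. Qed.

Lemma reached_iterate k : rch k -> F (x k).
Proof.
elim: k => [_|k IH rk]; first by case: run => _ [-> _].
have [[_ Fxs _ _ _] -> _ _] := reached_iteration rk.
by case: ifP => // _; apply: IH; exact: reachedW rk.
Qed.

Lemma sigma_min_le k : rch k -> sigma_min a <= sg k.
Proof.
have [_ _ /andP[_ s0] [_ e12 _] [_ g2 _]] := ha.
elim: k => [_|k IH rk]; first by case: run => _ [_ ->].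
have {}IH := IH (reachedW (leqnSn k) rk).
have smin : 0 < sigma_min a by case: ha => _ _ /andP[].
have [_ _ _ [h1 h2 h3]] := reached_iteration rk.
have [r2|r2] := leP (eta2 a) (rho p f c h z k).
  by have /andP[+ _] := h1 r2; rewrite ge_max => /andP[].
have [r1|r1] := leP (eta1 a) (rho p f c h z k).
  have /andP[g _] := h2 (introT andP (conj r1 r2)); exact: le_trans g.
have /andP[g _] := h3 r1; apply: le_trans g.
by rewrite (le_trans IH)// ler_peMl ?(ltW g2)// (le_trans (ltW smin)).
Qed.

Lemma sigma_gt0 k : rch k -> 0 < sg k.
Proof.
by move=> /sigma_min_le; apply: lt_le_trans; case: ha => _ _ /andP[].
Qed.

Lemma step_gt0 k : rch k.+1 -> 0 < norm2 (s k).
Proof. by case/reached_iteration=> -[s0 _ _ _ _] _ _ _; rewrite norm2_gt0. Qed.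

(** The regularization turns the decrease of the regularized model into a decrease
    of the unregularized one. *)
Lemma model_decrease k : rch k.+1 ->
  sg k / p.+1`!%:R * norm2 (s k) ^+ p.+1 <=
    W (x k) - taylor_w f c h p (x k) (s k).
Proof.
case/reached_iteration=> -[_ _ _ mle _] _ _ _; move: mle.
by rewrite (model0 p f c h) /model; lra.
Qed.

Lemma model_decrease_gt0 k : rch k.+1 ->
  0 < W (x k) - taylor_w f c h p (x k) (s k).
Proof.
move=> rk; apply: lt_le_trans (model_decrease rk).
rewrite mulr_gt0 ?exprn_gt0 ?step_gt0// divr_gt0 ?ltr0n ?fact_gt0//.
by apply: sigma_gt0; exact: reachedW rk.
Qed.

Lemma successful_decrease k : rch k.+1 -> succ k ->
  eta1 a * (sigma_min a / p.+1`!%:R) * norm2 (s k) ^+ p.+1 <= W (x k) - W (x k.+1).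
Proof.
move=> rk sk; have [_ _ _ [e1 _ _] _] := ha.
have [_ -> _ _] := reached_iteration rk; rewrite sk.
move: sk; rewrite /successful /rho ler_pdivlMr ?model_decrease_gt0// => sk.
apply: le_trans sk; rewrite -mulrA ler_wpM2l ?(ltW e1)//.
apply: le_trans (model_decrease rk).
rewrite ler_wpM2r ?exprn_ge0 ?norm2_ge0// ler_wpM2r ?invr_ge0//.
by apply: sigma_min_le; exact: reachedW rk.
Qed.

Lemma successful_lt k : rch k.+1 -> succ k -> W (x k.+1) < W (x k).
Proof.
move=> rk sk; rewrite -subr_gt0; apply: lt_le_trans (successful_decrease rk sk).
have [_ _ /andP[sm _] [e1 _ _] _] := ha.
by rewrite !mulr_gt0 ?exprn_gt0 ?step_gt0// ?invr_gt0 ?ltr0n ?fact_gt0.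
Qed.

Lemma unsuccessful_iterate k : rch k.+1 -> ~~ succ k -> x k.+1 = x k.
Proof. by move=> /reached_iteration[_ -> _ _] /negbTE ->. Qed.

(** A step that is not very successful has a model error of at least a fixed
    fraction of the decrease of the model; both are of the order |s|^(p+1). *)
Lemma sigma_le (G : R) : 0 <= G ->
  (forall x s, F x -> F (x + s) ->
    `|W (x + s) - taylor_w f c h p x s| <= G * norm2 s ^+ p.+1) ->
  forall k, rch k ->
    sg k <= Num.max (sigma0 a) (gamma3 a * (G * p.+1`!%:R / (1 - eta2 a))).
Proof.
move=> G0 hG; have [s0 _ _ [e1 e12 e2] [_ g2 g3]] := ha.
elim=> [_|k IH rk]; first by case: run => _ [_ -> _] _ _ _; rewrite le_max lexx.
have rk' := reachedW (leqnSn k) rk; have {}IH := IH rk'.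
have sk0 := sigma_gt0 rk'.
have [_ _ _ [h1 h2 h3]] := reached_iteration rk.
have [r2|r2] := leP (eta2 a) (rho p f c h z k).
  by have /andP[_ g] := h1 r2; exact: le_trans IH.
have sG : sg k <= G * p.+1`!%:R / (1 - eta2 a).
  have Fxs : F (x k + s k) by case: (reached_iteration rk) => -[].
  have err := le_trans (ler_norm _) (hG _ _ (reached_iterate rk') Fxs).
  have md := model_decrease rk.
  move: r2; rewrite /rho ltr_pdivrMr ?model_decrease_gt0// => r2.
  rewrite ler_pdivlMr ?subr_gt0// -ler_pdivrMr ?ltr0n ?fact_gt0//.
  have sp0 : 0 < norm2 (s k) ^+ p.+1 by rewrite exprn_gt0// step_gt0.
  rewrite -(ler_pM2r sp0); apply: le_trans err.
  rewrite mulrAC [X in X * _]mulrAC -mulrA mulrCA mulrA.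
  have := ler_wpM2r (ltW (etrans (subr_gt0 _ _) e2)) md; nra.
rewrite le_max; apply/orP; right.
have g30 : 0 < gamma3 a by lra.
apply: (@le_trans _ _ (gamma3 a * sg k)); last by rewrite ler_wpM2l// ltW.
have [r1|r1] := leP (eta1 a) (rho p f c h z k).
  have /andP[_ g] := h2 (introT andP (conj r1 r2)); apply: le_trans g _.
  by rewrite ler_wpM2r ?ltW.
by have /andP[] := h3 r1.
Qed.

Lemma delta_unit k : rch k -> in_unit q (it_delta z k).
Proof.
elim: k => [_|k IH rk]; first by case: run => _ [].
have [[_ _ du _ _] _ dE _] := reached_iteration rk.
move=> j jq; rewrite dE//; case: ifP => _; first exact: du.
by apply: IH => //; exact: reachedW rk.
Qed.

Lemma delta_one k : good_case q F h -> rch k ->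
  forall j, (1 <= j <= q)%N -> it_delta z k j = 1.
Proof.
move=> gc; have [_ _ _ [/(_ gc)[d0 ds] _]] := run.
elim: k => [_|k IH rk] j jq; first exact: d0.
have [_ _ dE _] := reached_iteration rk; rewrite dE//.
case: ifP => _; first exact: ds.
by apply: IH => //; exact: reachedW rk.
Qed.

(** At a new iterate that fails the test of some order j the measure of the
    objective exceeds that of the model by a fixed fraction of the threshold. *)
Lemma failed_test_step (S B : R) : (forall k, rch k -> sg k <= S) ->
  (forall x s sigma j delta, F x -> F (x + s) -> s != 0 -> (j <= p)%N ->
    0 <= sigma <= S -> 0 < delta ->
    attained (taylor_w_values F f c h j delta (x + s)) ->
    attained (taylor_model_values p F f c h x sigma j delta s) ->
    phi_w F f c h j delta (x + s) <= phi_model p F f c h x sigma j delta s +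
      B * (norm2 s ^+ p.+1 + norm2 s ^+ (p.+1 - j) * delta ^+ j)) ->
  forall k, rch k.+2 -> succ k -> exists2 j, (1 <= j <= q)%N &
    (1 - theta a) / q`!%:R * eps j * it_deltas z k j ^+ j <=
    B * (norm2 (s k) ^+ p.+1 + norm2 (s k) ^+ (p.+1 - j) * it_deltas z k j ^+ j).
Proof.
move=> sgS hB k rk2 sk; have [eps01 _ mins _] := run.
have rk1 := reachedW (leqnSn _) rk2; have rk := reachedW (leqnSn _) rk1.
have [[s0 Fxs du _ ms] xk dk _] := reached_iteration rk1.
rewrite sk in xk dk.
have : ~ optimality_test q F f c h eps (it_delta z k.+1) (x k.+1).
  by move=> ot; apply: (rk2 k.+1 (leqnn _)); left.
move/existsNP=> [j] /not_implyP[jq] /negP; rewrite -ltNge dk// xk => phi_gt.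
exists j => //; have /andP[_ jq'] := jq.
have [d0 d1] := andP (du j jq); have [e0 _] := andP (eps01 j jq).
have [minw _ _] := mins k.+1 rk1; have [_ minm _] := mins k rk.
have := hB (x k) (s k) (sg k) j (it_deltas z k j) (reached_iterate rk) Fxs s0
  (leq_trans jq' q_le_p) _ d0 _ _.
rewrite (ltW (sigma_gt0 rk)) sgS//= -xk => /(_ isT (minw _ _ jq d0)).
move=> /(_ (minm _ _ _ jq d0 Fxs)); rewrite xk => le1; have le2 := ms j jq.
have th1 : theta a < 1 by case: ha => _ /andP[].
set X := B * _ in le1 *.
have jfact : (q`!%:R : R)^-1 <= (j`!%:R)^-1.
  by rewrite lef_pV2 ?posrE ?ltr0n ?fact_gt0// ler_nat leq_fact.
apply: (@le_trans _ _ ((1 - theta a) * (eps j * it_deltas z k j ^+ j / j`!%:R))).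
  rewrite -!mulrA ler_wpM2l ?subr_ge0 ?(ltW th1)// mulrC -!mulrA.
  by rewrite ler_wpM2l ?(ltW e0)// ler_wpM2l// exprn_ge0// ltW.
move: phi_gt le1 le2; rewrite -!mulrA; set T := eps j * _; lra.
Qed.

Local Notation nsucc K := (count succ (iota 0 K)).
Local Notation nfail K := (count (predC succ) (iota 0 K)).

Lemma count_iotaS (b : pred nat) K :
  count b (iota 0 K.+1) = (count b (iota 0 K) + b K)%N.
Proof. by rewrite -addn1 iotaD count_cat /= addn0. Qed.

Lemma derivative_evaluationsE K :
  derivative_evaluations p f c h a z K = (nsucc K).+1.
Proof.
rewrite /derivative_evaluations /= add1n (iotaDl 1 0 K) count_map.
by congr (_.+1); apply: eq_count.
Qed.

Lemma objective_le K : rch K -> W (x K) <= W x0 /\ ((0 < nsucc K)%N -> W (x K) < W x0).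
Proof.
elim: K => [_|K IH rK]; first by case: run => _ [-> _].
have [le lt] := IH (reachedW (leqnSn _) rK); rewrite count_iotaS.
have [sK|sK] := boolP (succ K).
  have := successful_lt rK sK; split => [|_]; lra.
by rewrite addn0 unsuccessful_iterate.
Qed.

(** The last successful step, which leads to termination, is the only one whose
    decrease is not bounded below. *)
Lemma total_decrease (e : R) :
  (forall k, rch k.+2 -> succ k -> e <= W (x k) - W (x k.+1)) ->
  forall K, rch K.+1 -> W (x K) + e * (nsucc K)%:R <= W x0.
Proof.
move=> dec; elim=> [_|K IH rK].
  by rewrite mulr0 addr0; case: run => _ [-> _].
have rK1 := reachedW (leqnSn _) rK; have {}IH := IH rK1.
rewrite count_iotaS natrD mulrDr.
have [sK|sK] := boolP (succ K); last by rewrite mulr0 addr0 unsuccessful_iterate.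
by have := dec K rK sK; rewrite mulr1; lra.
Qed.

(** The single step without a lower bound on its decrease is counted by D^-1: it
    exists only if x0 is not a minimizer, so that 1 <= D^-1 (D / E). *)
Lemma successes_le (kappa E : R) : 0 < kappa -> 0 < E <= 1 ->
  (forall k, rch k.+2 -> succ k -> kappa * E <= W (x k) - W (x k.+1)) ->
  forall K, rch K -> (nsucc K)%:R <= (kappa^-1 + D^-1) * (D / E).
Proof.
move=> k0 /andP[E0 E1] dec [_|K rK].
  have D0 : 0 <= D by rewrite subr_ge0 as4.
  by rewrite mulr_ge0 ?addr_ge0 ?divr_ge0 ?invr_ge0// ltW.
have rK' := reachedW (leqnSn _) rK.
have [Wle Wlt] := objective_le rK.
have low : wlow <= W (x K.+1) by apply: as4; exact: reached_iterate.
have low' : wlow <= W (x K) by apply: as4; exact: reached_iterate.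
have D0 : 0 <= D by lra.
have tot := total_decrease dec rK.
have [nz|] := posnP (nsucc K.+1).
  by rewrite nz mulr_ge0 ?addr_ge0 ?divr_ge0 ?invr_ge0// ltW.
move=> /Wlt lt0; have {}D0 : 0 < D by lra.
rewrite mulrDl mulKf ?gt_eqF// count_iotaS natrD lerD//.
  rewrite mulrA ler_pdivlMr// mulrC -ler_pdivrMl ?invrK; last by rewrite invr_gt0.
  by rewrite mulrA; lra.
apply: (@le_trans _ _ 1); last by rewrite invf_ge1.
by case: (succ K).
Qed.

(** A successful iteration divides the weight by at most 1 / gamma1, an unsuccessful
    one multiplies it by at least gamma2. *)
Lemma sigma_count K : rch K ->
  sigma0 a * gamma1 a ^+ nsucc K * gamma2 a ^+ nfail K <= sg K.
Proof.
have [s0 _ _ [_ e12 _] [/andP[g10 g11] g2 _]] := ha.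
elim: K => [_|K IH rK]; first by rewrite !expr0 !mulr1; case: run => _ [_ ->].
have rK' := reachedW (leqnSn _) rK; have {}IH := IH rK'; have sK0 := sigma_gt0 rK'.
have [_ _ _ [h1 h2 h3]] := reached_iteration rK.
rewrite !count_iotaS /= /successful.
have [r1|r1] /= := leP (eta1 a) (rho p f c h z K).
  rewrite addn1 addn0 exprSr mulrA mulrAC.
  apply: (@le_trans _ _ (gamma1 a * sg K)).
    by rewrite mulrC ler_wpM2l// ltW.
  have [r2|r2] := leP (eta2 a) (rho p f c h z K).
    by have /andP[+ _] := h1 r2; rewrite ge_max => /andP[].
  have /andP[g _] := h2 (introT andP (conj r1 r2)); apply: le_trans g.
  by rewrite ler_piMl// ltW.
rewrite addn1 addn0 exprSr mulrA.
have /andP[g _] := h3 r1; apply: le_trans g.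
by rewrite mulrC ler_wpM2l// ltW// (lt_trans ltr01).
Qed.

(** As the weight stays below S, unsuccessful iterations must be compensated by
    successful ones; take logarithms in the preceding bound. *)
Lemma iterations_le (S : R) : sigma0 a <= S -> (forall k, rch k -> sg k <= S) ->
  forall K, rch K -> K%:R <= (1 - ln (gamma1 a) / ln (gamma2 a)) * (nsucc K)%:R +
    ln (S / sigma0 a) / ln (gamma2 a).
Proof.
move=> s0S sgS K rK.
have [s0 _ _ _ [/andP[g10 g11] g2 _]] := ha.
have g20 : 0 < gamma2 a by exact: lt_trans g2.
have lg2 : 0 < ln (gamma2 a) by rewrite ln_gt0.
have S0 : 0 < S by exact: lt_le_trans s0S.
have -> : K%:R = (nsucc K)%:R + (nfail K)%:R :> R.
  by rewrite -natrD count_predC size_iota.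
rewrite mulrBl mul1r -addrA lerD2l mulrAC -mulNr -mulrDl ler_pdivlMr// addrC.
have le : gamma1 a ^+ nsucc K * gamma2 a ^+ nfail K <= S / sigma0 a.
  rewrite ler_pdivlMr// mulrC mulrA; exact: le_trans (sigma_count rK) (sgS K rK).
move: le; rewrite -ler_ln ?posrE ?mulr_gt0 ?exprn_gt0 ?invr_gt0//.
rewrite [X in X <= _]lnM ?posrE ?exprn_gt0// (lnXn _ g10) (lnXn _ g20).
by rewrite -[_ *+ nsucc K]mulr_natr -[_ *+ nfail K]mulr_natl; lra.
Qed.

End OneRun.

(** Once every successful iteration which is not the last one decreases the
    objective by kappa E, the successful iterations are counted by the total
    decrease, and the unsuccessful ones by the growth of the regularization
    weight, which is bounded above. *)
Lemma complexity (kappa : R) : 0 < kappa -> exists ks ka kc : R,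
  [/\ 0 < ks, 0 < ka, 0 < kc & forall eps z (E : R), admissible_run eps z ->
    0 < E <= 1 ->
    (forall k, reached p q F f c h a eps z k.+2 -> successful p f c h a z k ->
      kappa * E <= W (it_x z k) - W (it_x z k.+1)) ->
    exists K, [/\ terminates_at p q F f c h a eps z K,
      (function_evaluations K)%:R <= ka * (D / E) + kc &
      (derivative_evaluations p f c h a z K)%:R <= ks * (D / E) + 1]].
Proof.
move=> k0; have [G G0 hG] := objective_error p_gt0 as1 as2 as3.
have [s0 _ _ _ [/andP[g10 g11] g2 _]] := ha.
have lg2 : 0 < ln (gamma2 a) by rewrite ln_gt0.
have lg1 : ln (gamma1 a) < 0 by rewrite ln_lt0// g10.
set S := Num.max (sigma0 a) (gamma3 a * (G * p.+1`!%:R / (1 - eta2 a))).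
have s0S : sigma0 a <= S by rewrite le_max lexx.
pose ks := kappa^-1 + D^-1.
have D0 : 0 <= D by rewrite subr_ge0 as4.
have ks0 : 0 < ks by rewrite ltr_pwDl ?invr_gt0// invr_ge0.
pose al := 1 - ln (gamma1 a) / ln (gamma2 a).
have al0 : 0 < al.
  by rewrite subr_gt0 (lt_trans _ ltr01)// pmulr_llt0 ?invr_gt0.
pose be := ln (S / sigma0 a) / ln (gamma2 a).
have be0 : 0 <= be.
  by rewrite divr_ge0 ?(ltW lg2)// ln_ge0// ler_pdivlMr// mul1r.
exists ks, (al * ks), (be + 1); split => //; [exact: mulr_gt0|lra|].
move=> eps z E run E01 dec.
have sgS := sigma_le run G0 hG.
have ns := successes_le run k0 E01 dec.
have itb K : reached p q F f c h a eps z K -> K%:R <= al * ks * (D / E) + be.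
  move=> rK; apply: (le_trans (iterations_le run s0S sgS rK)).
  by rewrite lerD2r -mulrA ler_wpM2l ?(ltW al0)// ns.
have [[K tK]|noK] := pselect (exists K, terminates_at p q F f c h a eps z K).
  have [rK _] := tK; exists K; split => //.
    by rewrite /function_evaluations -natr1; have := itb K rK; lra.
  by rewrite derivative_evaluationsE -natr1 lerD2r; exact: ns.
have rch K : reached p q F f c h a eps z K.
  elim: K => [//|K IH] i; rewrite ltnS leq_eqVlt => /predU1P[->|]; last exact: IH.
  by move=> stop; apply: noK; exists K.
have := itb _ (rch (Num.bound (al * ks * (D / E) + be))).
rewrite leNgt archi_boundP//.
by rewrite addr_ge0// !mulr_ge0 ?(ltW al0) ?(ltW ks0)// invr_ge0; case/andP: E01 => /ltW.
Qed.

(** Without an admissible pair the zero step minimizes the model, and small radii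
    pass the test. *)
Lemma final_accuracy eps z K : admissible_run eps z ->
  terminates_at p q F f c h a eps z K ->
  exists delta, in_unit q delta /\ forall j, (1 <= j <= q)%N ->
    phi_w F f c h j (delta j) (it_x z K) <= eps j * delta j ^+ j / j`!%:R.
Proof.
move=> run [rK [[_ ot]|np]]; first by exists (it_delta z K); split => //;
  exact: delta_unit run _ rK.
have [eps01 _ mins _] := run.
have /choice[delta hd] : forall j, exists delta : R, (1 <= j <= q)%N ->
    0 < delta <= 1 /\
    phi_w F f c h j delta (it_x z K) <= eps j * delta ^+ j / j`!%:R.
  move=> j; have [jq|_] := boolP (1 <= j <= q)%N; last by exists 0.
  have [delta d01 dphi] := phi_w_small p_gt0 as1 as2 as3 q_le_p ha eps01
    (reached_iterate run rK) (sigma_gt0 run rK) (mins K rK) np jq.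
  by exists delta.
by exists delta; split => j /hd[].
Qed.

Lemma final_accuracy1 eps z K : convex_set F -> convex_fun h -> q = 1%N ->
  admissible_run eps z -> terminates_at p q F f c h a eps z K ->
  phi_w F f c h 1 1 (it_x z K) <= eps 1%N.
Proof.
move=> cF ch q1 run [rK [[_ ot]|np]].
  have j1 : (1 <= 1 <= q)%N by rewrite q1.
  have gc : good_case q F h by split => //; right.
  have := ot 1%N j1; rewrite (delta_one run gc rK j1).
  by rewrite expr1n mulr1 (_ : 1`! = 1%N)// divr1.
have [eps01 _ mins _] := run.
exact: (phi_w_small1 p_gt0 as1 as2 as3 q_le_p ha eps01
  (reached_iterate run rK) (sigma_gt0 run rK) (mins K rK) np).
Qed.

(** The constant is uniform in the run and in the accuracies, because the bound on
    the weight is. *)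
Lemma successful_step : exists2 B : R, 0 <= B & forall eps z, admissible_run eps z ->
  forall k, reached p q F f c h a eps z k.+2 -> successful p f c h a z k ->
  exists2 j, (1 <= j <= q)%N &
    (1 - theta a) / q`!%:R * eps j * it_deltas z k j ^+ j <=
    B * (norm2 (it_s z k) ^+ p.+1 +
         norm2 (it_s z k) ^+ (p.+1 - j) * it_deltas z k j ^+ j).
Proof.
have [G G0 hG] := objective_error p_gt0 as1 as2 as3.
have [B B0 hB] := phi_w_le_phi_model p_gt0 as1 as2 as3
  (Num.max (sigma0 a) (gamma3 a * (G * p.+1`!%:R / (1 - eta2 a)))).
exists B => // eps z run k; exact: (failed_test_step run (sigma_le run G0 hG) hB).
Qed.

Let c0_gt0 : 0 < (1 - theta a) / q`!%:R.
Proof.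
by rewrite divr_gt0 ?ltr0n ?fact_gt0// subr_gt0; case: ha => _ /andP[].
Qed.

Let c1 : R := eta1 a * (sigma_min a / p.+1`!%:R).

Let c1_gt0 : 0 < c1.
Proof.
have [_ _ /andP[sm _] [e1 _ _] _] := ha.
by rewrite mulr_gt0// divr_gt0// ltr0n fact_gt0.
Qed.

Lemma decrease_convex : good_case q F h -> q = 1%N ->
  exists2 kappa : R, 0 < kappa & forall eps z, admissible_run eps z ->
  forall k, reached p q F f c h a eps z k.+2 -> successful p f c h a z k ->
  kappa * eps 1%N `^ (p.+1%:R / p%:R) <= W (it_x z k) - W (it_x z k.+1).
Proof.
move=> gc q1; have [B B0 hB] := successful_step.
have [kappa k0 hk] := step_lower_bound1 p_gt0 c0_gt0 B0.
exists (c1 * kappa) => [|eps z run k rk2 sk]; first exact: mulr_gt0.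
have rk1 := reachedW (leqnSn _) rk2.
apply: le_trans (successful_decrease run rk1 sk).
rewrite -mulrA ler_wpM2l ?(ltW c1_gt0)//.
have [eps01 _ _ [/(_ gc)[_ rr] _]] := run.
have [j jq] := hB eps z run k rk2 sk; rewrite (rr k rk1 j jq).
have -> : j = 1%N by move: jq; rewrite q1; case: j => [|[]].
rewrite expr1n !mulr1 subn1 => main.
by apply: hk main; [apply: eps01; rewrite q1|exact: norm2_ge0].
Qed.

Lemma Lwp_ge1 : 1 <= Lwp p Lf Lc Lh.
Proof.
have [_ Lf1 _] := as1; have [_ Lc1 _] := as2; have [Lh0 _ _ _] := as3.
by rewrite /Lwp ler_wpDr ?Lf1// mulr_ge0// (le_trans ler01)// Lc1.
Qed.

Lemma sigma_max_gt0 : 0 < sigma_max p a Lf Lc Lh.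
Proof. by rewrite /sigma_max lt_max; case: ha => ->. Qed.

Lemma xi_gt0 : 0 < xi p q a Lf Lc Lh.
Proof.
rewrite /xi powR_gt0// divr_gt0//; first by rewrite subr_gt0; case: ha => _ /andP[].
rewrite !mulr_gt0// ?ltr0n ?fact_gt0// addr_gt0// ?sigma_max_gt0//.
exact: lt_le_trans Lwp_ge1.
Qed.

Lemma kappa_delta_min_gt0 : 0 < kappa_delta_min p q a Lf Lc Lh.
Proof.
have [_ Lf1 _] := as1; have [_ Lc1 _] := as2; have [Lh0 _ _ _] := as3.
have th0 : 0 < theta a by case: ha => _ /andP[].
have Lw0 : 0 < Lw p Lf Lc Lh.
  apply: (@lt_le_trans _ _ (Lf 0%N + Lh * Lc 0%N)); last first.
    by rewrite /Lw; elim/big_rec: _ => // i y _ le; rewrite le_max le orbT.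
  by rewrite ltr_pwDl ?(lt_le_trans ltr01) ?Lf1// mulr_ge0// (le_trans ler01)// Lc1.
rewrite divr_gt0// !mulr_gt0// ?ltr0n ?fact_gt0//.
by rewrite addr_gt0// mulr_gt0// sigma_max_gt0.
Qed.

Lemma decrease_general : exists2 kappa : R, 0 < kappa &
  forall eps z, admissible_run eps z ->
  forall k, reached p q F f c h a eps z k.+2 -> successful p f c h a z k ->
  exists2 j, (1 <= j <= q)%N &
    kappa * eps j ^+ j.+1 <= W (it_x z k) - W (it_x z k.+1).
Proof.
have [B B0 hB] := successful_step.
pose kd := Num.min 1 (kappa_delta_min p q a Lf Lc Lh).
have kd0 : 0 < kd by rewrite lt_min ltr01 kappa_delta_min_gt0.
have [kappa k0 hk] := step_lower_bound q_le_p c0_gt0 B0 kd0 xi_gt0.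
exists (c1 * kappa) => [|eps z run k rk2 sk]; first exact: mulr_gt0.
have rk1 := reachedW (leqnSn _) rk2.
have [j jq main] := hB eps z run k rk2 sk; exists j => //.
apply: le_trans (successful_decrease run rk1 sk).
rewrite -mulrA ler_wpM2l ?(ltW c1_gt0)//.
have [eps01 _ _ [rr1 rr2]] := run.
have [[_ _ du _ _] _ _ _] := reached_iteration run rk1.
have [e0 e1] := andP (eps01 j jq).
apply: hk main => //; [exact: eps01|exact: du|exact: norm2_ge0|move=> sxi].
have [gc|ngc] := pselect (good_case q F h).
  have [_ ->//] := rr1 gc.
  by rewrite mulr_ile1 ?(ltW kd0) ?(ltW e0)// ge_min lexx.
apply: le_trans (rr2 ngc k rk1 sxi j jq).
by rewrite ler_wpM2r ?(ltW e0)// ge_min lexx orbT.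
Qed.

End Run.

(** * Minimal and maximal powers of the accuracies *)

Section MinEps.
Context {R : realType}.
Variables (q : nat) (eps : nat -> R).
Hypotheses (q_gt0 : (0 < q)%N) (eps01 : in_unit q eps).

Let eps_pow j : (1 <= j <= q)%N -> 0 < eps j ^+ j.+1 <= 1.
Proof.
move=> jq; have /andP[e0 e1] := eps01 jq.
by rewrite exprn_gt0// exprn_ile1// ltW.
Qed.

Lemma min_eps_le j : (1 <= j <= q)%N -> min_eps q eps <= eps j ^+ j.+1.
Proof.
move=> jq; have jr : j \in index_iota 1 q.+1 by rewrite mem_index_iota.
rewrite /min_eps; elim: (index_iota 1 q.+1) jr => // i r IH.
rewrite big_cons inE => /predU1P[->|/IH le]; first by rewrite ge_min lexx.
by rewrite ge_min le orbT.
Qed.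

Lemma min_eps_unit : 0 < min_eps q eps <= 1.
Proof.
have j1 : (1 <= 1 <= q)%N by rewrite q_gt0.
have [e0 e1] := andP (eps_pow j1); apply/andP; split; last first.
  exact: le_trans (min_eps_le j1) e1.
rewrite /min_eps big_nat; elim/big_rec: _ => // i y /eps_pow/andP[h _] y0.
by rewrite lt_min h.
Qed.

Lemma max_eps_invE : max_eps_inv q eps = (min_eps q eps)^-1.
Proof.
have key (r : seq nat) : {in r, forall j, (1 <= j <= q)%N} ->
    0 < \big[Num.min/eps 1%N ^+ 2]_(j <- r) eps j ^+ j.+1 /\
    \big[Num.max/eps 1%N ^- 2]_(j <- r) eps j ^- j.+1 =
    (\big[Num.min/eps 1%N ^+ 2]_(j <- r) eps j ^+ j.+1)^-1.
  elim: r => [_|i r IH ir].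
    by rewrite !big_nil; have /andP[] := eps_pow (introT andP (conj (leqnn 1) q_gt0)).
  have ir' : {in r, forall j, (1 <= j <= q)%N}.
    by move=> j jr; apply: ir; rewrite inE jr orbT.
  have [m0 me] := IH ir'.
  have /andP[i0 _] := eps_pow (ir i (mem_head _ _)).
  rewrite !big_cons me; split; first by rewrite lt_min i0.
  have [le|lt] := leP (eps i ^+ i.+1) (\big[Num.min/eps 1%N ^+ 2]_(j <- r) eps j ^+ j.+1).
    by apply/max_idPl; rewrite lef_pV2.
  by apply/max_idPr; rewrite lef_pV2// ltW.
by have [|_] := key (index_iota 1 q.+1); first by move=> j; rewrite mem_index_iota.
Qed.

End MinEps.

(** * The evaluation complexity *)

Theorem theorem5p6 (R : realType) (n m p q : nat) (F : set 'rV[R]_n)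
    (f : 'rV[R]_n -> R) (c : 'rV[R]_n -> 'rV[R]_m) (h : 'rV[R]_m -> R)
    (Lf Lc : nat -> R) (Lh wlow : R) (a : params R) (x0 : 'rV[R]_n)
    (n_ge1 : (1 <= n)%N) (m_ge1 : (1 <= m)%N) (q_ge1 : (1 <= q)%N)
    (q_le_p : (q <= p)%N)
    (as1 : AS1 p F f Lf) (as2 : AS2 p F c Lc) (as3 : AS3 h Lh)
    (as4 : AS4 F f c h wlow) (ha : valid_params a) (hx0 : F x0) :
  ((convex_set F /\ q = 1%N /\ convex_fun h) ->
   exists ks ka kc : R, [/\ 0 < ks, 0 < ka, 0 < kc,
     (forall (eps : nat -> R) (z : iterates R n), in_unit q eps ->
        is_run p q F f c h a x0 eps z ->
        run_minima_attained p q F f c h a eps z ->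
        radius_rule p q F f c h a eps z Lf Lc Lh ->
        exists K : nat, [/\ terminates_at p q F f c h a eps z K,
          (function_evaluations K)%:R
            <= ka * ((w f c h x0 - wlow) / eps 1%N `^ (p.+1%:R / p%:R)) + kc,
          (derivative_evaluations p f c h a z K)%:R
            <= ks * ((w f c h x0 - wlow) / eps 1%N `^ (p.+1%:R / p%:R)) + 1 &
          phi_w F f c h 1 1 (it_x z K) <= eps 1%N]) &
     exists C : R, forall e : R, 0 < e <= 1 ->
       ka * ((w f c h x0 - wlow) / e `^ (p.+1%:R / p%:R)) + kc
         <= C * e `^ (- (p.+1%:R / p%:R)) /\
       ks * ((w f c h x0 - wlow) / e `^ (p.+1%:R / p%:R)) + 1
         <= C * e `^ (- (p.+1%:R / p%:R))]) /\
  ((~ convex_set F \/ ~ convex_fun h \/ (1 < q)%N) ->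
   exists ks ka kc : R, [/\ 0 < ks, 0 < ka, 0 < kc,
     (forall (eps : nat -> R) (z : iterates R n), in_unit q eps ->
        is_run p q F f c h a x0 eps z ->
        run_minima_attained p q F f c h a eps z ->
        radius_rule p q F f c h a eps z Lf Lc Lh ->
        exists K : nat, [/\ terminates_at p q F f c h a eps z K,
          (function_evaluations K)%:R
            <= ka * ((w f c h x0 - wlow) / min_eps q eps) + kc,
          (derivative_evaluations p f c h a z K)%:R
            <= ks * ((w f c h x0 - wlow) / min_eps q eps) + 1 &
          exists delta : nat -> R, in_unit q delta /\
            forall j, (1 <= j <= q)%N ->
              phi_w F f c h j (delta j) (it_x z K)
                <= eps j * delta j ^+ j / j`!%:R]) &
     exists C : R, forall eps : nat -> R, in_unit q eps ->
       ka * ((w f c h x0 - wlow) / min_eps q eps) + kc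
         <= C * max_eps_inv q eps /\
       ks * ((w f c h x0 - wlow) / min_eps q eps) + 1
         <= C * max_eps_inv q eps]).
Proof.
set W := w f c h x0 - wlow.
have W0 : 0 <= W by rewrite subr_ge0 as4.
have bound (A ka kc ks : R) : 0 < ka -> 0 < kc -> 0 < ks -> 1 <= A ->
    ka * (W * A) + kc <= (ka * W + kc + (ks * W + 1)) * A /\
    ks * (W * A) + 1 <= (ka * W + kc + (ks * W + 1)) * A.
  move=> ka0 kc0 ks0 A1.
  have kaW : 0 <= ka * W by rewrite mulr_ge0// ltW.
  have ksW : 0 <= ks * W by rewrite mulr_ge0// ltW.
  by split; nra.
split.
- move=> [cF [q1 ch]].
  have gc : good_case q F h by split => //; right.
  have [kappa k0 hk] := decrease_convex q_ge1 q_le_p as1 as2 as3 ha hx0 gc q1.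
  have [ks [ka [kc [ks0 ka0 kc0 hc]]]] :=
    complexity q_ge1 q_le_p as1 as2 as3 as4 ha hx0 k0.
  exists ks, ka, kc; split => // [eps z eps01 run mins rr|].
    have arun : admissible_run p q F f c h Lf Lc Lh a x0 eps z by [].
    have e01 : 0 < eps 1%N <= 1 by apply: eps01; rewrite q1.
    have E01 : 0 < eps 1%N `^ (p.+1%:R / p%:R) <= 1.
      by have /andP[e0 e1] := e01; rewrite powR_gt0//= powR_le1 ?divr_ge0 ?(ltW e0).
    have [K [tK fK dK]] := hc eps z _ arun E01 (hk eps z arun).
    exists K; split => //.
    exact: (final_accuracy1 q_ge1 q_le_p as1 as2 as3 ha hx0 cF ch q1 arun tK).
  exists (ka * W + kc + (ks * W + 1)) => e /andP[e0 e1].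
  rewrite powRN; apply: bound => //.
  by rewrite invf_ge1 ?powR_gt0// powR_le1 ?divr_ge0 ?(ltW e0).
- move=> _.
  have [kappa k0 hk] := decrease_general q_ge1 q_le_p as1 as2 as3 ha hx0.
  have [ks [ka [kc [ks0 ka0 kc0 hc]]]] :=
    complexity q_ge1 q_le_p as1 as2 as3 as4 ha hx0 k0.
  exists ks, ka, kc; split => // [eps z eps01 run mins rr|].
    have arun : admissible_run p q F f c h Lf Lc Lh a x0 eps z by [].
    have [|K [tK fK dK]] := hc eps z _ arun (min_eps_unit q_ge1 eps01).
      move=> k rk sk; have [j jq le] := hk eps z arun k rk sk.
      by apply: le_trans le; rewrite ler_wpM2l ?(ltW k0)// min_eps_le.
    exists K; split => //.
    exact: (final_accuracy q_ge1 q_le_p as1 as2 as3 ha hx0 arun tK).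
  exists (ka * W + kc + (ks * W + 1)) => eps eps01.
  rewrite max_eps_invE//; apply: bound => //.
  by have /andP[m0 m1] := min_eps_unit q_ge1 eps01; rewrite invf_ge1.
Qed.
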